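(* Let $\Gamma$ be a weakly chordal graph which is triangle-free or square-free. Then $A(\Gamma)$ does not contain a subgroup isomorphic to $A(C_n)$ for any $n\ge 5$.
   Context: A graph is a simplicial 1-complex (no loops, no multi-edges). For a graph $\Gamma$ with vertex set $V(\Gamma)$ and edge set $E(\Gamma)$, the right-angled Artin group is $A(\Gamma)=\langle V(\Gamma)\mid [v,v']=1 \text{ for each } \{v,v'\}\in E(\Gamma)\rangle$. $C_n$ denotes the cycle of length $n$, and $X^{\mathrm{opp}}$ denotes the complement graph of $X$. A graph is weakly chordal if it contains no induced $C_n$ and no induced $C_n^{\mathrm{opp}}$ for $n\ge 5$. A graph is triangle-free (respectively square-free) if it contains no induced $C_3$ (respectively no induced $C_4$). *)

(* Defs.v *)
From HB Require Import structures.
From mathcomp Require Import all_boot.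
From mathcomp Require Import boolp.

Set Implicit Arguments.
Unset Strict Implicit.
Unset Printing Implicit Defensive.

Local Open Scope group_scope.
Local Open Scope quotient_scope.

(* Vertex sets are arbitrary types: no finiteness is assumed. *)
Record graph := Graph {
  vertex :> Type;
  adj : vertex -> vertex -> Prop;
  adj_sym : forall x y, adj x y -> adj y x;
  adj_irrefl : forall x, ~ adj x x
}.

Section Opposite.
Variable X : graph.

Definition opp_adj (x y : X) : Prop := x <> y /\ ~ adj x y.

Fact opp_adj_sym x y : opp_adj x y -> opp_adj y x.
Proof. by move=> [neq nadj]; split=> [/esym//|/adj_sym]. Qed.

Fact opp_adj_irrefl x : ~ opp_adj x x.
Proof. by case. Qed.

Definition opp_graph : graph := Graph opp_adj_sym opp_adj_irrefl.

End Opposite.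

Section Cycle.
Variable n : nat.

(* [ordS i] is i + 1 modulo n, so this is the cycle of length n as soon as
   3 <= n; the values at n < 3 are not meaningful. *)
Definition cycle_adj (i j : 'I_n) : Prop := i <> j /\ (j = ordS i \/ i = ordS j).

Fact cycle_adj_sym i j : cycle_adj i j -> cycle_adj j i.
Proof. by move=> [neq ij]; split; [move/esym | case: ij; [right | left]]. Qed.

Fact cycle_adj_irrefl i : ~ cycle_adj i i.
Proof. by case. Qed.

Definition cycle_graph : graph := Graph cycle_adj_sym cycle_adj_irrefl.

End Cycle.

Definition contains_induced (X Gamma : graph) : Prop :=
  exists f : X -> Gamma, injective f /\ forall x y, adj (f x) (f y) <-> adj x y.

Definition weakly_chordal (Gamma : graph) : Prop :=
  forall n : nat, (5 <= n)%N ->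
    ~ contains_induced (cycle_graph n) Gamma /\
    ~ contains_induced (opp_graph (cycle_graph n)) Gamma.

Definition triangle_free (Gamma : graph) : Prop :=
  ~ contains_induced (cycle_graph 3) Gamma.

Definition square_free (Gamma : graph) : Prop :=
  ~ contains_induced (cycle_graph 4) Gamma.

(* The letter (x, true) stands for the generator x and (x, false) for its
   inverse; [{classic X}] is X, made a choiceType by the axiom of choice. *)
Notation word X := (seq ({classic X} * bool)).

(* The group <X | r = 1 for all r with R r>, as a quotient of words. *)
Section Presentation.
Variables (X : Type) (R : word X -> Prop).

Inductive pres_eq : word X -> word X -> Prop :=
| PresRefl u : pres_eq u u
| PresSym u v : pres_eq u v -> pres_eq v u
| PresTrans u v w : pres_eq u v -> pres_eq v w -> pres_eq u w
| PresCancel u v x b : pres_eq (u ++ [:: (x, b); (x, ~~ b)] ++ v) (u ++ v)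
| PresRel u v r : R r -> pres_eq (u ++ r ++ v) (u ++ v).

Definition pres_rel : rel (word X) := fun u v => `[< pres_eq u v >].

Fact pres_rel_refl : reflexive pres_rel.
Proof. by move=> u; apply/asboolP/PresRefl. Qed.

Fact pres_rel_sym : symmetric pres_rel.
Proof. by move=> u v; apply/asboolP/asboolP => /PresSym. Qed.

Fact pres_rel_trans : transitive pres_rel.
Proof.
by move=> v u w /asboolP uv /asboolP vw; apply/asboolP/(PresTrans uv).
Qed.

Canonical pres_equiv := EquivRel pres_rel pres_rel_refl pres_rel_sym pres_rel_trans.

Definition presented := {eq_quot pres_rel}.
HB.instance Definition _ := Choice.on presented.
HB.instance Definition _ := EqQuotient.on presented.

Definition word_inv (u : word X) : word X := rev [seq (l.1, ~~ l.2) | l <- u].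

Lemma pres_piP u v : \pi_presented u = \pi_presented v <-> pres_eq u v.
Proof.
split=> [/eqP|uv]; first by rewrite piE => /asboolP.
by apply/eqP; rewrite piE; apply/asboolP.
Qed.

Lemma pres_eq_catl w u v : pres_eq u v -> pres_eq (w ++ u) (w ++ v).
Proof.
elim=> {u v} [u|u v _|u v z _ uv _|u v x b|u v r Rr].
- exact: PresRefl.
- exact: PresSym.
- exact: PresTrans.
- by rewrite !(catA w); apply: PresCancel.
- by rewrite !(catA w); apply: PresRel.
Qed.

Lemma pres_eq_catr w u v : pres_eq u v -> pres_eq (u ++ w) (v ++ w).
Proof.
elim=> {u v} [u|u v _|u v z _ uv _|u v x b|u v r Rr].
- exact: PresRefl.
- exact: PresSym.
- exact: PresTrans.
- by rewrite -!catA; apply: PresCancel.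
- by rewrite -!catA; apply: PresRel.
Qed.

Lemma word_invK : involutive word_inv.
Proof.
move=> u; rewrite /word_inv map_rev revK -map_comp map_id_in // => -[x b] _ /=.
by rewrite negbK.
Qed.

Lemma word_inv_cat u v : word_inv (u ++ v) = word_inv v ++ word_inv u.
Proof. by rewrite /word_inv map_cat rev_cat. Qed.

Lemma pres_eq_mulV u : pres_eq (u ++ word_inv u) [::].
Proof.
elim: u => [|[x b] u IHu]; first exact: PresRefl.
rewrite -cat1s word_inv_cat -catA (catA u).
apply: PresTrans (pres_eq_catl _ (pres_eq_catr _ IHu)) _.
exact: (PresCancel [::] [::]).
Qed.

Lemma pres_eq_Vmul u : pres_eq (word_inv u ++ u) [::].
Proof. by rewrite -{2}[u]word_invK; apply: pres_eq_mulV. Qed.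

Lemma pres_eq_inv u v : pres_eq u v -> pres_eq (word_inv u) (word_inv v).
Proof.
move=> uv; have := pres_eq_catr (word_inv v) (pres_eq_catl (word_inv u) uv).
rewrite -(catA _ v) => /(PresTrans)/(_ (pres_eq_catl _ (pres_eq_mulV v))).
rewrite cats0 => E; apply: PresSym; apply: PresTrans E.
by apply/PresSym/(pres_eq_catr (word_inv v) (pres_eq_Vmul u)).
Qed.

Definition pres_one : presented := \pi_presented [::].
Definition pres_mul (a b : presented) : presented :=
  \pi_presented (repr a ++ repr b).
Definition pres_inv (a : presented) : presented :=
  \pi_presented (word_inv (repr a)).

Lemma pres_eq_repr u : pres_eq (repr (\pi_presented u)) u.
Proof. by apply/pres_piP; rewrite reprK. Qed.

Lemma pres_mul_pi u v :
  pres_mul (\pi_presented u) (\pi_presented v) = \pi_presented (u ++ v).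
Proof.
apply/pres_piP; apply: PresTrans (pres_eq_catr _ (pres_eq_repr u)) _.
exact/pres_eq_catl/pres_eq_repr.
Qed.

Lemma pres_inv_pi u : pres_inv (\pi_presented u) = \pi_presented (word_inv u).
Proof. exact/pres_piP/pres_eq_inv/pres_eq_repr. Qed.

Fact pres_mulA : associative pres_mul.
Proof.
move=> a b c; rewrite -[a]reprK -[b]reprK -[c]reprK.
by rewrite (pres_mul_pi (repr b)) (pres_mul_pi (repr a) (repr b)) !pres_mul_pi catA.
Qed.

Fact pres_mul1 : left_id pres_one pres_mul.
Proof. by move=> a; rewrite -[a]reprK pres_mul_pi. Qed.

Fact pres_mul1r : right_id pres_one pres_mul.
Proof. by move=> a; rewrite -[a]reprK pres_mul_pi cats0. Qed.

Fact pres_mulV : left_inverse pres_one pres_inv pres_mul.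
Proof.
move=> a; rewrite -[a]reprK pres_inv_pi pres_mul_pi.
exact/pres_piP/pres_eq_Vmul.
Qed.

Fact pres_mulrV : right_inverse pres_one pres_inv pres_mul.
Proof.
move=> a; rewrite -[a]reprK pres_inv_pi pres_mul_pi.
exact/pres_piP/pres_eq_mulV.
Qed.

HB.instance Definition _ := isGroup.Build presented
  pres_mulA pres_mul1 pres_mul1r pres_mulV pres_mulrV.

Definition pres_gen (x : X) : presented := \pi_presented [:: (x : {classic X}, true)].

Definition word_eval (K : groupType) (g : X -> K) (u : word X) : K :=
  \prod_(l <- u) (if l.2 then g l.1 else (g l.1)^-1).

Lemma pres_universal (K : groupType) (g : X -> K) :
  (forall r, R r -> word_eval g r = 1) ->
  exists! f : presented -> K, {morph f : a b / a * b} /\ forall x, f (pres_gen x) = g x.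
Proof.
move=> gR.
have ev_cat u v : word_eval g (u ++ v) = word_eval g u * word_eval g v.
  by rewrite /word_eval big_cat.
have ev_eq u v : pres_eq u v -> word_eval g u = word_eval g v.
  elim=> {u v} [||u v w _ -> _ ->|u v x b|u v r /gR r1] //; rewrite !ev_cat.
    rewrite {2}/word_eval big_cons big_seq1 /=.
    by case: b; rewrite /= ?mulgV ?mulVg mul1g.
  by rewrite r1 mul1g.
pose f (a : presented) := word_eval g (repr a).
have f_pi u : f (\pi_presented u) = word_eval g u.
  exact/ev_eq/pres_eq_repr.
exists f; split.
  split=> [a b|x]; last by rewrite f_pi /word_eval big_seq1.
  by rewrite -[a]reprK -[b]reprK [_ * _]pres_mul_pi !f_pi ev_cat.
move=> h [hM hg]; apply/funext => a; rewrite -[a]reprK f_pi.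
have h1 : h 1 = 1 by apply: (mulgI (h 1)); rewrite -hM !mulg1.
elim: (repr a) => [|[x b] u IHu]; first by rewrite /word_eval big_nil -h1.
rewrite -cat1s ev_cat -pres_mul_pi hM -IHu; congr (_ * _).
rewrite /word_eval big_seq1 /=; case: b; first by rewrite -hg.
have -> : \pi_presented [:: (x, false)] = (pres_gen x)^-1.
  by rewrite [RHS]pres_inv_pi.
by apply: (mulIg (h (pres_gen x))); rewrite -hM -hg !mulVg h1.
Qed.

End Presentation.

(* The relator [v, v'] is the word v^-1 v'^-1 v v'. *)
Definition raag_relator (Gamma : graph) (r : word Gamma) : Prop :=
  exists v v' : {classic Gamma}, adj (v : Gamma) (v' : Gamma) /\
    r = [:: (v, false); (v', false); (v, true); (v', true)].

Definition raag (Gamma : graph) : groupType := presented (@raag_relator Gamma).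

Definition has_subgroup_isomorphic_to (G H : groupType) : Prop :=
  exists (S : pred G) (K : subGroupType S) (f : {multiplicative H -> K}),
    bijective f.

Lemma has_subgroup_isomorphicP (G H : groupType) :
  has_subgroup_isomorphic_to G H <->
  exists f : {multiplicative H -> G}, injective f.
Proof.
split=> [[S [K [f /bij_inj fI]]]|[f fI]].
  by exists ((val : K -> G) \o f)%FUN; apply: inj_comp fI; apply: val_inj.
pose S : pred G := fun x => `[< exists y, f y = x >].
have Sf y : S (f y) by apply/asboolP; exists y.
have f1 : f 1 = 1 by apply: (mulgI (f 1)); rewrite -gmulfM !mulg1.
have fF x y : f (x / y) = f x / f y.
  by apply: (mulIg (f y)); rewrite -gmulfM !mulgVK.
have Sclosed : group_closed S.
  split=> [|x y /asboolP[a <-] /asboolP[b <-]].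
    by rewrite -f1; apply: Sf.
  by rewrite -fF; apply: Sf.
pose KM := SubChoice_isSubGroup.Build G S {x | S x} Sclosed.
pose K : subGroupType S := HB.pack {x | S x} KM.
pose g (y : H) : K := exist _ (f y) (Sf y).
have gM : {morph g : x y / x * y}.
  by move=> x y; apply: val_inj; rewrite valM /=; apply: gmulfM.
pose gm : {multiplicative H -> K} := HB.pack g (isMultiplicative.Build H K g gM).
exists S, K, gm.
have gI : injective g by move=> x y /(congr1 val)/fI.
have gS (z : K) : exists y, g y = z.
  case: z => x Sx; have /asboolP[y fy] := Sx.
  by exists y; apply: val_inj.
have [h hK] := choice gS.
by exists h => // y; apply: gI; rewrite hK.
Qed.

(* Main.v *)
(* Since A(C_n) embeds in A(Gamma), there are elements g_0, ..., g_(n-1) of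
   A(Gamma) such that g_i and g_j commute exactly when i and j are adjacent in
   C_n.  Weakly chordal graphs are chordal when square-free, and have no
   induced cycle of length 3 or at least 5 when triangle-free; for Gamma in
   either of these two classes such a cyclic sequence cannot exist.

   The tool is unfolding: the kernel of the v-exponent A(Gamma) -> Z is the
   right-angled Artin group on infinitely many copies of Gamma minus the star
   of v, glued along the link of v.  Both classes are stable under unfolding,
   and the letter v disappears from every word.  If instead g has a nonzero
   v-exponent, then the elements of exponent 0 commuting with g are
   simultaneously conjugate into the link of v.  By induction on word length
   this describes the g whose centralizer is not abelian: up to conjugation
   they lie in a clique (chordal case), or in one side of a complete bipartite
   subgraph whose other side contains their neighbours in the cycle
   (triangle-free case).  Hence g_i may be replaced by a conjugate of a new
   vertex added to the graph without leaving the class.  Once all g_i are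
   conjugates of vertices, unfolding shortens the conjugators until the g_i are
   vertices of an induced cycle, which is a contradiction. *)

From HB Require Import structures.
From Stdlib Require Import ZArith.
Require Import Defs.
From mathcomp Require Import all_boot.
From mathcomp Require Import boolp zify.

Set Implicit Arguments.
Unset Strict Implicit.
Unset Printing Implicit Defensive.

Local Open Scope group_scope.
Local Open Scope quotient_scope.

(** * Words and homomorphisms *)

Section CommuteTheory.
Variable G : groupType.
Implicit Types x y z c : G.

Lemma commuteJ c x y : commute (x ^ c) (y ^ c) <-> commute x y.
Proof.
by rewrite /commute -!conjMg; split=> [/conjg_inj|->].
Qed.

Lemma conj_fix_commute c x : x ^ c = x <-> commute x c.
Proof.
rewrite /commute; split=> [xc|xc]; first by rewrite conjgC xc.
by rewrite conjgE xc mulKg.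
Qed.

Lemma commute_mull x y z : commute x z -> commute y z -> commute (x * y) z.
Proof. by move=> xz yz; apply/commute_sym/commuteM; apply/commute_sym. Qed.

Lemma commute_cancelr x y z : commute (x * y) z -> commute y z -> commute x z.
Proof.
move=> xyz yz; rewrite -(mulgK y x).
by apply: commute_mull xyz _; apply/commute_sym/commuteV/commute_sym.
Qed.

Lemma commute_Xl x y k : commute x y -> commute (x ^+ k) y.
Proof. by move=> xy; apply/commute_sym/commuteX/commute_sym. Qed.

End CommuteTheory.

Section Words.
Variable Gamma : graph.
Implicit Types (x v : Gamma) (u : word Gamma) (a b : raag Gamma).

Definition gen x : raag Gamma := pres_gen (@raag_relator Gamma) x.

Definition letter (l : {classic Gamma} * bool) : raag Gamma :=
  if l.2 then gen l.1 else (gen l.1)^-1.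

Definition wd u : raag Gamma := word_eval gen u.

Lemma wd_nil : wd [::] = 1.
Proof. exact: big_nil. Qed.

Lemma wd_cons l u : wd (l :: u) = letter l * wd u.
Proof. exact: big_cons. Qed.

Lemma wd_cat u w : wd (u ++ w) = wd u * wd w.
Proof. exact: big_cat. Qed.

Lemma wd_pi u : wd u = \pi_(presented (@raag_relator Gamma)) u.
Proof.
elim: u => [|[x b] u IHu]; first by rewrite wd_nil.
rewrite wd_cons IHu -cat1s -pres_mul_pi; congr (_ * _).
rewrite /letter; case: b => //=; rewrite /gen /pres_gen.
exact: pres_inv_pi.
Qed.

Lemma wd_repr a : wd (repr a) = a.
Proof. by rewrite wd_pi reprK. Qed.

Lemma wd_eqP u w : wd u = wd w <-> pres_eq (@raag_relator Gamma) u w.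
Proof. by rewrite !wd_pi; apply: pres_piP. Qed.

Lemma raag_ind (P : raag Gamma -> Prop) :
  P 1 -> (forall x a, P a -> P (gen x * a)) ->
  (forall x a, P a -> P ((gen x)^-1 * a)) -> forall a, P a.
Proof.
move=> P1 Pg PV a; rewrite -(wd_repr a); elim: (repr a) => [|[x [|]] u IHu].
- by rewrite wd_nil.
- by rewrite wd_cons; apply: Pg.
- by rewrite wd_cons; apply: PV.
Qed.

Lemma gen_commute x v : adj x v -> commute (gen x) (gen v).
Proof.
move=> xv; pose r : word Gamma := [:: (x, false); (v, false); (x, true); (v, true)].
have /wd_eqP : pres_eq (@raag_relator Gamma) ([::] ++ r ++ [::]) ([::] ++ [::]).
  by apply: PresRel; exists x, v.
rewrite !wd_cons wd_nil /letter /= mulg1 => E.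
rewrite /commute; apply: (mulgI ((gen v)^-1)); apply: (mulgI ((gen x)^-1)).
by rewrite mulKg mulVg.
Qed.

Definition compat (K : groupType) (phi : Gamma -> K) :=
  forall x y, adj x y -> commute (phi x) (phi y).

Section Lift.
Variables (K : groupType) (phi : Gamma -> K) (phiC : compat phi).

Definition raag_lift of compat phi := fun a => word_eval phi (repr a).

Lemma word_eval_cat u w : word_eval phi (u ++ w) = word_eval phi u * word_eval phi w.
Proof. exact: big_cat. Qed.

Lemma raag_lift_wd u : raag_lift phiC (wd u) = word_eval phi u.
Proof.
have /wd_eqP := wd_repr (wd u); rewrite /raag_lift; move: (repr _) => w.
elim=> {w u} [||u v w _ -> _ ->|u v x b|u v r [x [y [xy ->]]]] //.
- rewrite !word_eval_cat {2}/word_eval !big_cons big_nil /= mulg1.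
  by case: b; rewrite /= ?mulgV ?mulVg mul1g.
- rewrite !word_eval_cat {2}/word_eval !big_cons big_nil /= mulg1.
  by rewrite (phiC xy) mulKg mulVg mul1g.
Qed.

Lemma raag_liftM : {morph raag_lift phiC : a b / a * b}.
Proof.
by move=> a b; rewrite -(wd_repr a) -(wd_repr b) -wd_cat !raag_lift_wd word_eval_cat.
Qed.

Lemma raag_lift1 : raag_lift phiC 1 = 1.
Proof. by rewrite -wd_nil raag_lift_wd /word_eval big_nil. Qed.

HB.instance Definition _ := isUMagmaMorphism.Build _ _ (raag_lift phiC) (raag_lift1, raag_liftM).

Lemma raag_lift_gen x : raag_lift phiC (gen x) = phi x.
Proof.
have -> : gen x = wd [:: (x : {classic Gamma}, true)] by rewrite wd_cons wd_nil mulg1.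
by rewrite raag_lift_wd /word_eval big_seq1.
Qed.

End Lift.

Lemma hom_eq (K : groupType) (f h : UMagmaMorphism.type (raag Gamma) K) :
  (forall x, f (gen x) = h (gen x)) -> f =1 h.
Proof.
move=> fh; apply: raag_ind => [|x a IH|x a IH]; first by rewrite !gmulf1.
  by rewrite !gmulfM IH fh.
by rewrite !gmulfM !gmulfV IH fh.
Qed.

End Words.

(** * Exponents and retractions *)

Section Exponent.
Variables (Gamma : graph) (v : Gamma).
Implicit Types (u : word Gamma) (a b : raag Gamma).

Definition sgnZ (b : bool) : Z := if b then 1%Z else (-1)%Z.

Definition lexpo (l : {classic Gamma} * bool) : Z :=
  if l.1 == (v : {classic Gamma}) then sgnZ l.2 else 0%Z.

Fixpoint wexpo u : Z := if u is l :: u' then (lexpo l + wexpo u')%Z else 0%Z.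

Lemma wexpo_cat u w : wexpo (u ++ w) = (wexpo u + wexpo w)%Z.
Proof. by elim: u => //= l u ->; lia. Qed.

Lemma lexpoN (x : {classic Gamma}) (b : bool) : lexpo (x, ~~ b) = (- lexpo (x, b))%Z.
Proof. by rewrite /lexpo /=; case: eqP; case: b. Qed.

Lemma wexpo_pres u w : pres_eq (@raag_relator Gamma) u w -> wexpo u = wexpo w.
Proof.
elim=> {u w} [||u w z _ -> _ ->|u w x b|u w r [x [y [xy ->]]]] //.
- by rewrite !wexpo_cat /= lexpoN; lia.
- rewrite !wexpo_cat /= (lexpoN x true) (lexpoN y true); lia.
Qed.

Definition expo a : Z := wexpo (repr a).

Lemma expo_wd u : expo (wd u) = wexpo u.
Proof. by apply/wexpo_pres/wd_eqP/wd_repr. Qed.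

Lemma expoM a b : expo (a * b) = (expo a + expo b)%Z.
Proof. by rewrite -(wd_repr a) -(wd_repr b) -wd_cat !expo_wd wexpo_cat. Qed.

Lemma expo1 : expo 1 = 0%Z.
Proof. by rewrite -wd_nil expo_wd. Qed.

Lemma expoV a : expo a^-1 = (- expo a)%Z.
Proof. by have := expoM a a^-1; rewrite mulgV expo1; lia. Qed.

Lemma expoX a k : expo (a ^+ k) = (Z.of_nat k * expo a)%Z.
Proof. by elim: k => [|k IHk]; rewrite ?expo1 // expgS expoM IHk; lia. Qed.

Lemma expoJ a b : expo (a ^ b) = expo a.
Proof. by rewrite conjgE !expoM expoV; lia. Qed.

Lemma expo_gen : expo (gen v) = 1%Z.
Proof.
have -> : gen v = wd [:: (v : {classic Gamma}, true)] by rewrite wd_cons wd_nil mulg1.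
by rewrite expo_wd /= /lexpo /= eqxx.
Qed.

Lemma expo_gen_neq x : x <> v -> expo (gen x) = 0%Z.
Proof.
have -> : gen x = wd [:: (x : {classic Gamma}, true)] by rewrite wd_cons wd_nil mulg1.
by rewrite expo_wd /= /lexpo /=; case: eqP.
Qed.

End Exponent.

Section Retraction.
Variable Gamma : graph.
Implicit Types (S T : Gamma -> Prop) (a b : raag Gamma).

Definition keep S (x : Gamma) : raag Gamma := if `[< S x >] then gen x else 1.

Fact keep_compat S : compat (keep S).
Proof.
move=> x y xy; rewrite /keep; do 2?case: ifP => _.
- exact: gen_commute.
- exact: commute1.
- exact/commute_sym/commute1.
- exact: commute1.
Qed.

Definition ret S := raag_lift (keep_compat S).
HB.instance Definition _ S := UMagmaMorphism.copy (ret S) (raag_lift (keep_compat S)).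

Lemma ret1 S : ret S 1 = 1.
Proof. exact: gmulf1. Qed.

Lemma retM S a b : ret S (a * b) = ret S a * ret S b.
Proof. exact: gmulfM. Qed.

Lemma retV S a : ret S a^-1 = (ret S a)^-1.
Proof. exact: gmulfV. Qed.

Lemma retX S a k : ret S (a ^+ k) = ret S a ^+ k.
Proof. exact: gmulfXn. Qed.

Lemma retJ S a b : ret S (a ^ b) = ret S a ^ ret S b.
Proof. exact: gmulfJ. Qed.

(** Membership in the subgroup generated by [S], encoded as a fixed-point equation so that
    intersections come from composing retractions. *)
Definition par S a := ret S a = a.

Lemma ret_gen S x : S x -> ret S (gen x) = gen x.
Proof. by move=> Sx; rewrite [LHS]raag_lift_gen /keep asboolT. Qed.

Lemma ret_genN S x : ~ S x -> ret S (gen x) = 1.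
Proof. by move=> Sx; rewrite [LHS]raag_lift_gen /keep asboolF. Qed.

Lemma retI S T a : ret S (ret T a) = ret (fun x => S x /\ T x) a.
Proof.
move: a; apply: (@hom_eq _ _ (ret S \o ret T)%FUN) => x /=.
have [Tx|Tx] := pselect (T x); last by rewrite !ret_genN ?ret1 // => -[].
rewrite (ret_gen Tx); have [Sx|Sx] := pselect (S x); first by rewrite !ret_gen.
by rewrite !ret_genN // => -[].
Qed.

Lemma eq_ret S T a : (forall x, S x <-> T x) -> ret S a = ret T a.
Proof.
move=> ST; move: a; apply: hom_eq => x /=.
have [Sx|Sx] := pselect (S x); first by rewrite !ret_gen //; apply/ST.
by rewrite !ret_genN // => /ST.
Qed.

Lemma par_ret S a : par S (ret S a).
Proof. by rewrite /par retI; apply: eq_ret => x; split=> [[]|]. Qed.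

Lemma par_sub S T a : (forall x, S x -> T x) -> par S a -> par T a.
Proof.
move=> ST <-; rewrite /par retI; apply: eq_ret => x.
by split=> [[]|] // Sx; split=> //; apply: ST.
Qed.

Lemma parI S T a : par S a -> par T a -> par (fun x => S x /\ T x) a.
Proof. by rewrite /par -retI => Sa ->. Qed.

Lemma par1 S : par S 1.
Proof. exact: ret1. Qed.

Lemma parM S a b : par S a -> par S b -> par S (a * b).
Proof. by rewrite /par retM => -> ->. Qed.

Lemma parV S a : par S a -> par S a^-1.
Proof. by rewrite /par retV => ->. Qed.

Lemma parX S a k : par S a -> par S (a ^+ k).
Proof. by rewrite /par retX => ->. Qed.

Lemma parJ S a b : par S a -> par S b -> par S (a ^ b).
Proof. by rewrite /par retJ => -> ->. Qed.

Lemma par_gen S x : S x -> par S (gen x).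
Proof. exact: ret_gen. Qed.

Lemma par_wd S (u : word Gamma) : (forall l, l \in u -> S l.1) -> par S (wd u).
Proof.
elim: u => [|l u IHu] Su; first by rewrite wd_nil; apply: par1.
rewrite wd_cons; apply: parM; last by apply: IHu => k ku; apply: Su; rewrite inE ku orbT.
have /par_gen Sl : S l.1 by apply: Su; rewrite mem_head.
by rewrite /letter; case: l.2 => //; apply: parV.
Qed.

Lemma ret_ind S (P : raag Gamma -> Prop) :
  P 1 -> (forall a b, P a -> P b -> P (a * b)) -> (forall a, P a -> P a^-1) ->
  (forall x, S x -> P (gen x)) -> forall a, P (ret S a).
Proof.
move=> P1 PM PV Pg; apply: raag_ind => [|x a IH|x a IH]; first by rewrite ret1.
  rewrite retM; apply: PM => //.
  by have [Sx|Sx] := pselect (S x); [rewrite ret_gen //; apply: Pg | rewrite ret_genN].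
rewrite retM retV; apply: PM => //; apply: PV.
by have [Sx|Sx] := pselect (S x); [rewrite ret_gen //; apply: Pg | rewrite ret_genN].
Qed.

Lemma par_ind S (P : raag Gamma -> Prop) :
  P 1 -> (forall a b, P a -> P b -> P (a * b)) -> (forall a, P a -> P a^-1) ->
  (forall x, S x -> P (gen x)) -> forall a, par S a -> P a.
Proof. by move=> P1 PM PV Pg a <-; apply: ret_ind. Qed.

Lemma ret_eq1 S T a : (forall x, S x -> ~ T x) -> par T a -> ret S a = 1.
Proof.
move=> ST; move: a; apply: (@par_ind T (fun a => ret S a = 1)) => [|b c eb ec|b eb|x Tx]; rewrite ?ret1 //.
- by rewrite retM eb ec mulg1.
- by rewrite retV eb invg1.
- by rewrite ret_genN // => /ST.
Qed.

Lemma par0 S a : (forall x, ~ S x) -> par S a -> a = 1.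
Proof. by move=> S0 Sa; rewrite -Sa; apply: ret_eq1 Sa. Qed.

Lemma commute_par S T a b :
  (forall x y, S x -> T y -> commute (gen x) (gen y)) ->
  par S a -> par T b -> commute a b.
Proof.
move=> ST Sa Tb.
have gb x : S x -> commute (gen x) b.
  move=> Sx; move: b Tb; apply: (@par_ind T (fun b => commute (gen x) b)) => [|b c|b|y].
  - exact: commute1.
  - exact: commuteM.
  - exact: commuteV.
  - exact: ST.
move: a Sa; apply: (@par_ind S (fun a => commute a b)) => // [|a c|a ac].
- exact/commute_sym/commute1.
- exact: commute_mull.
- exact/commute_sym/commuteV/commute_sym.
Qed.

Lemma expo_ret_out S x a : ~ S x -> expo x (ret S a) = 0%Z.
Proof.
move=> Sx; move: a; apply: (@ret_ind S (fun a => expo x a = 0%Z)) => [|a b ea eb|a ea|y Sy].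
- exact: expo1.
- by rewrite expoM ea eb.
- by rewrite expoV ea.
- by apply: expo_gen_neq => xy; apply: Sx; rewrite -xy.
Qed.

Lemma expo_par_out S x a : ~ S x -> par S a -> expo x a = 0%Z.
Proof. by move=> Sx <-; apply: expo_ret_out. Qed.

Lemma expo_ret_in S x a : S x -> expo x (ret S a) = expo x a.
Proof.
move=> Sx; move: a; apply: raag_ind => [|y a IH|y a IH]; first by rewrite ret1.
  rewrite retM !expoM IH; have [Sy|Sy] := pselect (S y); first by rewrite ret_gen.
  by rewrite ret_genN // expo1 expo_gen_neq // => yx; apply: Sy; rewrite yx.
rewrite retM retV !expoM IH !expoV; have [Sy|Sy] := pselect (S y); first by rewrite ret_gen.
by rewrite ret_genN // expo1 expo_gen_neq // => yx; apply: Sy; rewrite yx.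
Qed.

Definition restrict S (u : word Gamma) : word Gamma :=
  [seq l : {classic Gamma} * bool <- u | `[< S l.1 >]].

Lemma ret_wd S (u : word Gamma) : ret S (wd u) = wd (restrict S u).
Proof.
elim: u => [|l u IHu]; first by rewrite wd_nil ret1.
rewrite wd_cons retM IHu /restrict /= /letter.
case: asboolP => Sl; last by case: l.2; rewrite ?retV ret_genN ?invg1 ?mul1g.
by rewrite wd_cons /letter; case: l.2; rewrite ?retV ret_gen.
Qed.

End Retraction.

Section IntegerPower.
Variables (G : groupType) (g : G).

(** One of the two factors is always trivial, which avoids a case distinction on the sign of [j]. *)
Definition zpow (j : Z) : G := g ^+ Z.to_nat j * g^-1 ^+ Z.to_nat (- j).

Lemma zpow0 : zpow 0 = 1.
Proof. by rewrite /zpow mulg1. Qed.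

Lemma zpowS j : zpow (j + 1) = zpow j * g.
Proof.
rewrite /zpow; have [j0|j0] := Z.le_gt_cases 0 j.
  have -> : Z.to_nat (j + 1) = (Z.to_nat j).+1 by lia.
  have -> : Z.to_nat (- (j + 1)) = 0%N by lia.
  have -> : Z.to_nat (- j) = 0%N by lia.
  by rewrite !mulg1 expgSr.
have -> : Z.to_nat (j + 1) = 0%N by lia.
have -> : Z.to_nat (- j) = (Z.to_nat (- (j + 1))).+1 by lia.
have -> : Z.to_nat j = 0%N by lia.
by rewrite !mul1g [X in _ = X * g]expgSr mulgVK.
Qed.

Lemma zpowP j : zpow (j - 1) = zpow j * g^-1.
Proof.
have -> : zpow j = zpow (j - 1) * g by rewrite -zpowS; congr zpow; lia.
by rewrite mulgK.
Qed.

Lemma commute_zpow h j : commute h g -> commute h (zpow j).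
Proof. by move=> hg; apply: commuteM; apply: commuteX => //; apply: commuteV. Qed.

End IntegerPower.

(** * Unfolding *)

Section Unfold.
Variables (Gamma : graph) (v : Gamma).

Definition unfold_adj (p q : Gamma * Z) : Prop :=
  [/\ adj p.1 q.1, p.1 <> v /\ q.1 <> v, adj v p.1 -> p.2 = 0%Z,
      adj v q.1 -> q.2 = 0%Z & ~ adj v p.1 -> ~ adj v q.1 -> p.2 = q.2].

Fact unfold_adj_sym p q : unfold_adj p q -> unfold_adj q p.
Proof.
case=> pq [pv qv] p0 q0 lv; split=> //; first exact: adj_sym.
by move=> nq np; rewrite lv.
Qed.

Fact unfold_adj_irrefl p : ~ unfold_adj p p.
Proof. by case=> /adj_irrefl. Qed.

(* Levels are powers of [v]: a vertex [w] outside the star of [v] has a copy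
   [(w, j)] for each [j], standing for the conjugate of [w] by [v^j]; a vertex [w]
   of the link only has the copy [(w, 0)].  The other pairs are isolated. *)
Definition unfold : graph := Graph unfold_adj_sym unfold_adj_irrefl.

Definition lev (w : Gamma) (j : Z) : Z := if `[< adj v w >] then 0%Z else j.

(* Reidemeister-Schreier rewriting of a word read from level [j]. *)
Fixpoint unf (j : Z) (u : word Gamma) : word unfold :=
  if u is l :: u' then
    if l.1 == (v : {classic Gamma}) then unf (j + sgnZ l.2)%Z u'
    else ((l.1, lev l.1 j) : {classic unfold}, l.2) :: unf j u'
  else [::].

Lemma unf_cat j u w : unf j (u ++ w) = unf j u ++ unf (j + wexpo v u)%Z w.
Proof.
elim: u j => [|l u IHu] j /=; first by congr unf; lia.
rewrite /lexpo; case: ifP => _; rewrite IHu /= //.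
by congr (_ ++ unf _ _); lia.
Qed.

Lemma size_unf j u : (size (unf j u) <= size u)%N.
Proof.
by elim: u j => [|l u IHu] j //=; case: ifP => _ /=; rewrite ?ltnS ?IHu // leqW.
Qed.

Lemma size_unf_lt j u : (v : {classic Gamma}) \in map fst u -> (size (unf j u) < size u)%N.
Proof.
elim: u j => [|l u IHu] j //=; rewrite inE => /orP[/eqP<-|vu].
  by rewrite eqxx ltnS size_unf.
by case: ifP => _ /=; rewrite ltnS ?size_unf //; apply: IHu.
Qed.

Lemma unf_adj x y j : adj x y -> x <> v -> y <> v ->
  unfold_adj (x, lev x j) (y, lev y j).
Proof.
move=> xy xv yv; split=> //=; rewrite /lev.
- by move=> vx; rewrite asboolT.
- by move=> vy; rewrite asboolT.
- by move=> vx vy; rewrite !asboolF.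
Qed.

Lemma unf_pres u w : pres_eq (@raag_relator Gamma) u w ->
  forall j, wd (unf j u) = wd (unf j w).
Proof.
elim=> {u w} [|u w _ IH j|u w z _ IH _ IH' j|u w x b j|u w r [x [y [xy ->]]] j] //.
- by rewrite IH IH'.
- rewrite !unf_cat !wd_cat; congr (_ * _); set k := (j + wexpo v u)%Z.
  have -> : (k + wexpo v [:: (x, b); (x, ~~ b)])%Z = k by rewrite /= lexpoN; lia.
  suff -> : wd (unf k [:: (x, b); (x, ~~ b)]) = 1 by rewrite mul1g.
  rewrite /=; case: (x == _); rewrite ?wd_nil // !wd_cons wd_nil mulg1 /letter /=.
  by case: b; rewrite /= ?mulgV ?mulVg.
- rewrite !unf_cat !wd_cat; congr (_ * _).
  set k := (j + wexpo v u)%Z.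
  have -> : (k + wexpo v [:: (x, false); (y, false); (x, true); (y, true)])%Z = k.
    by rewrite /= (lexpoN v x true) (lexpoN v y true); lia.
  suff -> : wd (unf k [:: (x, false); (y, false); (x, true); (y, true)]) = 1 by rewrite mul1g.
  (* If one letter is [v], the other lies in its link and gets level 0 on either side of [v], so the
     relator rewrites to cancelling letters. *)
  rewrite /=; have [xv|xv] := eqVneq x (v : {classic Gamma}).
    have yv : (y == (v : {classic Gamma})) = false.
      by apply/eqP => yv; move: xy; rewrite xv yv => /adj_irrefl.
    rewrite yv !wd_cons wd_nil /letter /= mulg1 /lev asboolT ?mulVg //.
    by rewrite -xv.
  have [yv|yv] := eqVneq y (v : {classic Gamma}).
    rewrite !wd_cons wd_nil /letter /= mulg1 /lev asboolT ?mulVg //.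
    by rewrite -yv; apply: adj_sym.
  rewrite !wd_cons wd_nil /letter /= mulg1.
  have C := @gen_commute unfold (x, lev x k) (y, lev y k) (unf_adj k xy (elimN eqP xv) (elimN eqP yv)).
  by rewrite C mulKg mulVg.
Qed.

Definition unfE (j : Z) (a : raag Gamma) : raag unfold := wd (unf j (repr a)).

Lemma unfE_wd j u : unfE j (wd u) = wd (unf j u).
Proof. by apply: unf_pres; apply/wd_eqP/wd_repr. Qed.

(** Multiplicativity up to a shift of level, hence a homomorphism on the kernel of [expo v]. *)
Lemma unfEM j a b : unfE j (a * b) = unfE j a * unfE (j + expo v a) b.
Proof.
by rewrite -(wd_repr a) -(wd_repr b) -wd_cat !unfE_wd unf_cat wd_cat expo_wd.
Qed.

Lemma unfE1 j : unfE j 1 = 1.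
Proof. by rewrite -wd_nil unfE_wd wd_nil. Qed.

Lemma unfEX a k : expo v a = 0%Z -> unfE 0 (a ^+ k) = unfE 0 a ^+ k.
Proof.
move=> a0; elim: k => [|k IHk]; first exact: unfE1.
by rewrite !expgS unfEM a0 IHk.
Qed.

Lemma unfE_commute a b : expo v a = 0%Z -> expo v b = 0%Z -> commute a b ->
  commute (unfE 0 a) (unfE 0 b).
Proof. by move=> a0 b0 /(congr1 (unfE 0)); rewrite !unfEM a0 b0. Qed.

(** As [x ^ y] stands for [y^-1 * x * y], the inverse puts the positive power of [v] on the left. *)
Definition fold_gen (p : unfold) : raag Gamma := gen p.1 ^ (zpow (gen v) p.2)^-1.

Lemma fold_gen_link w j k : adj v w -> fold_gen (w, j) = gen w ^ (zpow (gen v) k)^-1.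
Proof.
move=> vw; rewrite /fold_gen /=.
have C l : gen w ^ (zpow (gen v) l)^-1 = gen w.
  by apply/conj_fix_commute/commuteV/commute_zpow/gen_commute/adj_sym.
by rewrite !C.
Qed.

Fact fold_compat : compat fold_gen.
Proof.
move=> [x i] [y j] [/= xy _ x0 y0 ij].
have [vx|vx] := pselect (adj v x).
  by rewrite (fold_gen_link i j vx) /fold_gen /= commuteJ; apply: gen_commute.
have [vy|vy] := pselect (adj v y).
  by rewrite (fold_gen_link j i vy) /fold_gen /= commuteJ; apply: gen_commute.
by rewrite /fold_gen /= ij // commuteJ; apply: gen_commute.
Qed.

Definition fold := raag_lift fold_compat.
HB.instance Definition _ := UMagmaMorphism.copy fold (raag_lift fold_compat).

Lemma fold1 : fold 1 = 1.
Proof. exact: gmulf1. Qed.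

Lemma foldM a b : fold (a * b) = fold a * fold b.
Proof. exact: gmulfM. Qed.

Lemma foldV a : fold a^-1 = (fold a)^-1.
Proof. exact: gmulfV. Qed.

Lemma foldX a k : fold (a ^+ k) = fold a ^+ k.
Proof. exact: gmulfXn. Qed.

Lemma foldJ a b : fold (a ^ b) = fold a ^ fold b.
Proof. exact: gmulfJ. Qed.

Lemma fold_lev w k : fold_gen (w, lev w k) = gen w ^ (zpow (gen v) k)^-1.
Proof.
by rewrite /lev; case: asboolP => // vw; apply: fold_gen_link.
Qed.

(** The conjugating powers of [v] telescope, leaving only the initial and the final level. *)
Lemma fold_unf j u :
  fold (wd (unf j u)) = zpow (gen v) j * wd u * (zpow (gen v) (j + wexpo v u))^-1.
Proof.
elim: u j => [|[x b] u IHu] j /=.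
  by rewrite !wd_nil fold1 mulg1 Z.add_0_r mulgV.
rewrite wd_cons {1}/lexpo /=; case: eqP => [->|xv] /=.
  rewrite IHu Z.add_assoc; congr (_ / _); rewrite mulgA; congr (_ * _).
  by rewrite /letter /=; case: b => /=; rewrite ?zpowS // -zpowP.
rewrite wd_cons foldM IHu /letter /=.
have F : fold (gen ((x, lev x j) : unfold)) = zpow (gen v) j * gen x * (zpow (gen v) j)^-1.
  by rewrite [LHS]raag_lift_gen fold_lev conjgE invgK mulgA.
move: F; move: (zpow (gen v) j) (zpow (gen v) (j + _)) => z z' F.
by case: b; rewrite ?foldV F ?invgM ?invgK !mulgA mulgVK.
Qed.

Lemma fold_unfE a : expo v a = 0%Z -> fold (unfE 0 a) = a.
Proof.
by move=> a0; rewrite -(wd_repr a) unfE_wd fold_unf -expo_wd wd_repr a0 zpow0 mul1g invg1 mulg1.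
Qed.

End Unfold.

Lemma par_word (Gamma : graph) (S : Gamma -> Prop) (a : raag Gamma) :
  par S a -> exists2 u : word Gamma, (forall l, l \in u -> S l.1) & a = wd u.
Proof.
move=> Sa; exists (restrict S (repr a)).
  by move=> l; rewrite mem_filter => /andP[/asboolP].
by rewrite -ret_wd wd_repr.
Qed.

Lemma par_ret2 (Gamma : graph) (S T : Gamma -> Prop) (a : raag Gamma) : par S a -> par S (ret T a).
Proof.
by move=> Sa; rewrite /par retI -{2}Sa retI; apply: eq_ret => x; split=> -[].
Qed.

Section UnfoldPar.
Variables (Gamma : graph) (v : Gamma).

Lemma par_fold (S : unfold v -> Prop) (T : Gamma -> Prop) (a : raag (unfold v)) :
  T v -> (forall p, S p -> T p.1) -> par S a -> par T (fold a).
Proof.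
move=> Tv ST; apply: (@par_ind _ S (fun a => par T (fold a))) => [|b c|b|p Sp].
- by rewrite fold1; apply: par1.
- by rewrite foldM; apply: parM.
- by rewrite foldV; apply: parV.
- rewrite [fold _]raag_lift_gen; apply: parJ; first exact/par_gen/ST.
  by apply/parV/parM; apply: parX; [|apply: parV]; apply: par_gen.
Qed.

Lemma mem_unf (u : word Gamma) j l : l \in unf v j u ->
  exists2 k, k \in u & k.1 = l.1.1 :> Gamma.
Proof.
elim: u j => [|k u IHu] j //=; case: ifP => _.
  by move=> /IHu[m mu ml]; exists m; rewrite // inE mu orbT.
rewrite inE => /orP[/eqP->|/IHu[m mu ml]]; first by exists k; rewrite ?mem_head.
by exists m; rewrite // inE mu orbT.
Qed.

Lemma mem_unf_level (u : word Gamma) j l : l \in unf v j u ->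
  (Z.abs l.1.2 <= Z.abs j + Z.of_nat (size u))%Z.
Proof.
elim: u j => [|[x b] u IHu] j //=; case: ifP => _.
  by move=> /IHu h; apply: Z.le_trans h _; case: b; rewrite /sgnZ /=; lia.
rewrite inE => /orP[/eqP->|/IHu h]; last by apply: Z.le_trans h _; lia.
by rewrite /= /lev; case: ifP => _; lia.
Qed.

Lemma par_unfE (S : Gamma -> Prop) (a : raag Gamma) j :
  par S a -> par (fun p : unfold v => S p.1) (unfE v j a).
Proof.
move=> /par_word[u Su ->]; rewrite unfE_wd; apply: par_wd => l /mem_unf[k ku <-].
exact: Su.
Qed.

Definition near (M : nat) (p : unfold v) : Prop :=
  adj v p.1 \/ (Z.abs p.2 <= Z.of_nat M)%Z.

Lemma par_near (M : nat) (u : word Gamma) : (size u <= M)%N ->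
  par (near M) (wd (unf v 0 u)).
Proof. by move=> uM; apply: par_wd => l /mem_unf_level; right; lia. Qed.

(** Each letter moves the level by at most one, so the level stays beyond [M] throughout; only link
    letters, which are near for every [M], survive. *)
Lemma fold_ret_far (M : nat) (u : word Gamma) j :
  (Z.abs j > Z.of_nat (M + size u))%Z ->
  fold (ret (near M) (wd (unf v j u))) = ret (adj v) (wd u).
Proof.
elim: u j => [|[x b] u IHu] j /= jM; first by rewrite !wd_nil !ret1 fold1.
rewrite wd_cons retM; case: eqP => [->|xv].
  rewrite IHu; last by case: b; rewrite /sgnZ /=; lia.
  suff -> : ret (adj v) (letter (v : {classic Gamma}, b)) = 1 by rewrite mul1g.
  by rewrite /letter; case: b; rewrite /= ?retV ret_genN ?invg1 //; apply: adj_irrefl.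
rewrite wd_cons retM foldM IHu; last lia.
congr (_ * _).
suff E : fold (ret (near M) (gen ((x, lev v x j) : unfold v))) = ret (adj v) (gen x).
  by rewrite /letter; case: b; rewrite /= ?retV ?foldV E.
have [vx|vx] := pselect (adj v x).
  rewrite !ret_gen //; last by left.
  by rewrite [LHS]raag_lift_gen (fold_gen_link _ 0) // zpow0 invg1 conjg1.
rewrite !ret_genN ?fold1 // => -[] //=.
by rewrite /lev asboolF //; lia.
Qed.

(* For k large, [g ^+ k] carries the part of [x] outside the link of [v] to
   levels of [unfold v] disjoint from those of [x]; killing the far levels
   in [x * g ^+ k = g ^+ k * x] then conjugates [x] into the link of [v]. *)
Lemma commute_expo_conj (g x y : raag Gamma) :
  expo v g <> 0%Z -> commute x g -> commute y g ->
  expo v x = 0%Z -> expo v y = 0%Z ->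
  exists c, [/\ forall S, par S g -> par S c,
    x ^ c = ret (adj v) x & y ^ c = ret (adj v) y].
Proof.
move=> g0 xg yg x0 y0.
pose M := (size (repr x) + size (repr y))%N.
(* After [g ^+ K] the word of [z] is read from a level of absolute value at least [K], which exceeds
   [M + size (repr z)]. *)
pose K := M.*2.+1.
pose c := fold (ret (near M) (unfE v 0 (g ^+ K))).
have main (z : raag Gamma) : (size (repr z) <= M)%N -> commute z g -> expo v z = 0%Z ->
    z ^ c = ret (adj v) z.
  move=> zM zg z0.
  have := congr1 (unfE v 0) (commuteX K zg).
  rewrite !unfEM z0 => /(congr1 (fun a => fold (ret (near M) a))).
  rewrite !retM !foldM -/c [unfE v 0 z](_ : _ = wd (unf v 0 (repr z))) //.
  rewrite (par_near zM) -[wd (unf v 0 (repr z))]unfE_wd wd_repr fold_unfE //.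
  rewrite -{2}(wd_repr z) unfE_wd fold_ret_far; last first.
    have e1 : (1 <= Z.abs (expo v g))%Z by lia.
    have {}e1 := Z.mul_le_mono_nonneg_l _ _ (Z.of_nat K) (Zle_0_nat K) e1.
    by rewrite expoX Z.add_0_l Z.abs_mul; move: zM e1; rewrite /K; lia.
  by rewrite wd_repr conjgE => ->; rewrite mulKg.
exists c; split; [|by apply: main; rewrite // /M ?leq_addr ?leq_addl..].
move=> S Sg; have Sv : S v by apply: contrapT => /expo_par_out/(_ Sg).
apply: (@par_fold (fun p => S p.1)) => //; apply: par_ret2.
exact/par_unfE/parX.
Qed.

End UnfoldPar.

(** * Roots and torsion *)

(** A letter [v] outside [S] has exponent 0 in [a], because a positive multiple of that exponent
    vanishes; unfolding at [v] then shortens the word. *)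
Lemma par_root (Gamma : graph) (S : Gamma -> Prop) (a : raag Gamma) k :
  par S (a ^+ k.+1) -> par S a.
Proof.
rewrite -(wd_repr a); move: (repr a) => {a} u.
have [m um] := ubnP (size u).
elim: m Gamma S u um => // m IHm Gamma S u um Sa.
have [Su|] := pselect (forall l, l \in u -> S l.1); first exact: par_wd.
move=> /existsNP[[v b] /not_implyP[vu Sv]].
have v0 : expo v (wd u) = 0%Z.
  by have := expo_par_out Sv Sa; rewrite expoX => /Z.eq_mul_0[]; first lia.
rewrite -(fold_unfE v0) unfE_wd.
(* Words in [S] never meet [v], so they unfold to level 0 only, and [fold] sends the level 0 copies
   back to [S]. *)
have : par (fun p : unfold v => S p.1 /\ p.2 = 0%Z) (wd (unf v 0 u)).
  apply: IHm.
    exact: leq_trans (size_unf_lt 0 (map_f fst vu)) um.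
  rewrite -unfE_wd -unfEX // -Sa.
  have : par S (ret S (wd u ^+ k.+1)) by apply: par_ret.
  move=> /par_word[w Sw ->]; rewrite unfE_wd; apply: par_wd.
  elim: w Sw => [|[x c] w IHw] Sw l //=.
  have Sx : S x by apply: (Sw (x, c)); rewrite mem_head.
  case: eqP => [xv|_]; first by case: Sv; rewrite -xv.
  rewrite inE => /orP[/eqP-> /=|]; first by split=> //; rewrite /lev; case: ifP.
  by apply: IHw => k' kw; apply: Sw; rewrite inE kw orbT.
apply: (@par_ind _ _ (fun a => par S (fold a))) => [|b1 c|b1|[x j] /= [Sx ->]].
- by rewrite fold1; apply: par1.
- by rewrite foldM; apply: parM.
- by rewrite foldV; apply: parV.
- by rewrite [fold _]raag_lift_gen /fold_gen /= zpow0 invg1 conjg1; apply: par_gen.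
Qed.

Lemma raag_torsion_free (Gamma : graph) (a : raag Gamma) k : a ^+ k.+1 = 1 -> a = 1.
Proof.
move=> ak; apply: (@par0 Gamma (fun=> False)) => [x []|].
by apply: (@par_root Gamma _ _ k); rewrite ak; apply: par1.
Qed.

Lemma size_restrict_lt (Gamma : graph) (S : Gamma -> Prop) (u : word Gamma) (v : Gamma) :
  (v : {classic Gamma}) \in map fst u -> ~ S v -> (size (restrict S u) < size u)%N.
Proof.
move=> /mapP[l lu vl] Sv; rewrite size_filter ltn_neqAle count_size andbT.
by apply/negP; rewrite -all_count => /allP/(_ l lu)/asboolP; rewrite -vl.
Qed.

(* In the last case [q = a b a^-1 b^-1] and its conjugate by [a] lie in a common
   conjugate of the link of some letter [v] of [a]; there [a] acts as its
   shorter retract, so it commutes with [q], and [q ^+ k.+1 = 1]. *)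
Lemma commute_root (Gamma : graph) (a b : raag Gamma) k :
  commute (a ^+ k.+1) b -> commute a b.
Proof.
rewrite -(wd_repr a); move: (repr a) => {a} u.
have [m um] := ubnP (size u).
elim: m Gamma u um b => // m IHm Gamma u um b; set a' := wd u => ab.
have [[v vu v0]|nz] := pselect (exists2 v : Gamma, (v : {classic Gamma}) \in map fst u
    & expo v a' = 0%Z).
  have [b0|b0] := pselect (expo v b = 0%Z).
    rewrite -(fold_unfE v0) -(fold_unfE b0); apply: (gmulf_commute (@fold _ v)).
    rewrite /a' unfE_wd; apply: IHm; first exact: leq_trans (size_unf_lt 0 vu) um.
    rewrite -unfE_wd -unfEX //; apply: unfE_commute => //.
    by rewrite expoX v0; lia.
  (* Now [b], of nonzero exponent, makes the power of [a'] conjugate into the link of [v]. By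
     [par_root] so is [a'], and its retract is a shorter word. *)
  have ak0 : expo v (a' ^+ k.+1) = 0%Z by rewrite expoX v0; lia.
  have [c [_ akc _]] := commute_expo_conj b0 ab ab ak0 ak0.
  have ac : par (adj v) (a' ^ c).
    by apply: (@par_root _ _ _ k); rewrite -conjXg akc; apply: par_ret.
  have {}ac : a' = ret (adj v) a' ^ (ret (adj v) c * c^-1).
    by rewrite conjgM -retJ ac conjgK.
  move: ab; rewrite ac -conjXg -(conjgKV (ret (adj v) c * c^-1) b) !commuteJ.
  rewrite /a' ret_wd; apply: IHm.
  exact: leq_trans (size_restrict_lt vu (@adj_irrefl Gamma v)) um.
have [u0|] := eqVneq u [::]; first by rewrite /a' u0 wd_nil; apply/commute_sym/commute1.
case: u um @a' ab nz => // -[v sg] u um a' ab nz _.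
have va : expo v a' <> 0%Z by move=> v0; apply: nz; exists v; rewrite ?mem_head.
have vak : expo v (a' ^+ k.+1) <> 0%Z by rewrite expoX; nia.
pose q := b ^ a'^-1 * b^-1.
have qak : commute q (a' ^+ k.+1).
  apply/commute_sym/commuteM; last exact: commuteV.
  rewrite -(_ : (a' ^+ k.+1) ^ a'^-1 = a' ^+ k.+1) ?commuteJ //.
  by apply/conj_fix_commute/commuteV/commute_Xl.
have q0 : expo v q = 0%Z by rewrite expoM expoJ expoV; lia.
have qak' : commute (q ^ a'^-1) (a' ^+ k.+1).
  rewrite -(_ : (a' ^+ k.+1) ^ a'^-1 = a' ^+ k.+1) ?commuteJ //.
  by apply/conj_fix_commute/commuteV/commute_Xl.
have q0' : expo v (q ^ a'^-1) = 0%Z by rewrite expoJ.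
have [c [_ qc qc']] := commute_expo_conj vak qak qak' q0 q0'.
set r := ret (adj v) in qc qc'.
have rq : r (q ^ c) = q ^ c by rewrite qc; apply: par_ret.
have rq' : r ((q ^ a'^-1) ^ c) = (q ^ a'^-1) ^ c by rewrite qc'; apply: par_ret.
have s_comm : commute (r (a' ^ c)) (q ^ c).
  rewrite /r retJ -(conjgKV (r c) (q ^ c)) commuteJ ret_wd.
  apply: IHm.
    have vin : (v : {classic Gamma}) \in map fst ((v : {classic Gamma}, sg) :: u).
      exact: mem_head.
    exact: leq_trans (size_restrict_lt vin (@adj_irrefl Gamma v)) um.
  rewrite -[wd _]ret_wd -/a' -/r -(commuteJ (r c)) conjgKV conjXg -retJ -rq -retX.
  apply: (gmulf_commute (ret (adj v))); rewrite -conjXg commuteJ.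
  exact: commute_sym.
have qa : commute q a'.
  rewrite -(commuteJ c); move: rq'; rewrite conjJg conjVg /r retJ retV -/r rq.
  have /conj_fix_commute -> := commuteV (commute_sym s_comm).
  by move=> /esym/conj_fix_commute/commuteV; rewrite invgK.
(* At [i = k.+1] the conjugation fixes [b], which turns this formula into [q ^+ k.+1 = 1]. *)
have bq i : b ^ (a'^-1 ^+ i) = q ^+ i * b.
  elim: i => [|i IHi]; first by rewrite conjg1 mul1g.
  rewrite expgSr conjgM IHi conjMg expgSr -(mulgA _ q b); congr (_ * _).
    by apply/conj_fix_commute/commuteV/commute_Xl.
  by rewrite /q mulgVK.
have q1 : q = 1.
  apply: (@raag_torsion_free _ _ k); apply: (mulIg b); rewrite mul1g -bq.
  by apply/conj_fix_commute; rewrite expVgn; apply/commuteV/commute_sym.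
apply/commute_sym; rewrite -(invgK a'); apply: commuteV; apply/conj_fix_commute.
by rewrite -[RHS]mul1g -q1 mulgVK.
Qed.

(** * Centralizers *)

Section Centralizers.
Variable Gamma : graph.
Implicit Types (v x y : Gamma) (g a b z : raag Gamma).

Definition star v x := x = v \/ adj v x.

(** Supplies the exponent 0 that [commute_expo_conj] requires. The integer power of [g] is written
    as a quotient of natural powers, and the product still commutes with [g] whenever [a] does. *)
Lemma balance v g a : expo v g <> 0%Z ->
  exists k m n, expo v (a ^+ k.+1 * (g ^+ m / g ^+ n)) = 0%Z.
Proof.
move=> g0; exists (Z.to_nat (Z.abs (expo v g))).-1.
exists (Z.to_nat (- expo v a * Z.sgn (expo v g))), (Z.to_nat (expo v a * Z.sgn (expo v g))).
rewrite !expoM expoV !expoX.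
have -> : Z.of_nat (Z.to_nat (Z.abs (expo v g))).-1.+1 = Z.abs (expo v g) by lia.
move: (expo v a) (expo v g) g0 => d e e0.
have := Zabs_spec e; have := Z.sgn_spec e; move: (Z.sgn e) (Z.abs e) => s t.
have : (Z.of_nat (Z.to_nat (- d * s)) - Z.of_nat (Z.to_nat (d * s)) = - (d * s))%Z by lia.
move: (Z.of_nat (Z.to_nat (- d * s))) (Z.of_nat (Z.to_nat (d * s))) => p q pq.
have -> : (p * e + - (q * e) = (p - q) * e)%Z by lia.
by rewrite pq; case=> [[? ->]|[[? ->]|[? ->]]] [] [? ->]; nia.
Qed.

Lemma commute_divX g a m n : commute a g -> commute a (g ^+ m / g ^+ n).
Proof. by move=> ag; apply: commuteM; [|apply: commuteV]; apply: commuteX. Qed.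

(** A balanced power of [a] is moved into the link of [v] by a conjugator from the subgroup of [K],
    which commutes with [v]; so it commutes with [v] before conjugation too. The factor in [g] is
    then dropped and the root taken. *)
Lemma commute_support (K : Gamma -> Prop) v g a :
  par K g -> (forall x, K x -> star v x) -> expo v g <> 0%Z ->
  commute a g -> commute a (gen v).
Proof.
move=> Kg Kv g0 ag; have [k [m [n]]] := balance a g0.
set z := g ^+ m / g ^+ n; set b := a ^+ k.+1 * z => b0.
have Kgen d : par K d -> commute d (gen v).
  move=> Kd; apply: (@commute_par _ K (eq v)) Kd (par_gen (erefl v)) => x _ /Kv + <-.
  by case=> [->|/gen_commute/commute_sym].
have Kz : par K z by apply/parM/parV; apply: parX.
have bg : commute b g.
  apply: commute_mull; first exact: commute_Xl.
  exact/commute_sym/commute_divX.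
have [c [/(_ K Kg) Kc bc _]] := commute_expo_conj g0 bg bg b0 b0.
have bv : commute b (gen v).
  rewrite -(commuteJ c) bc (_ : gen v ^ c = gen v); last first.
    by apply/conj_fix_commute/commute_sym/Kgen.
  apply: (@commute_par _ (adj v) (eq v)) (par_ret _ _) (par_gen (erefl v)) => x _ vx <-.
  exact/gen_commute/adj_sym.
by apply: (@commute_root _ _ _ k); apply: commute_cancelr bv (Kgen _ Kz).
Qed.

(** For [gen v] the conjugator into the link lies in the subgroup of [v], so it acts trivially on
    the link. *)
Lemma commute_gen_expo0 v a : commute a (gen v) -> expo v a = 0%Z -> par (adj v) a.
Proof.
move=> av a0; have v0 : expo v (gen v) <> 0%Z by rewrite expo_gen.
have [c [/(_ (eq v) (par_gen (erefl v))) vc ac _]] := commute_expo_conj v0 av av a0 a0.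
suff -> : a = ret (adj v) a by apply: par_ret.
rewrite -[LHS](conjgK c) ac; apply/conj_fix_commute/commuteV.
apply: (@commute_par _ (adj v) (eq v)) (par_ret _ _) vc => x _ vx <-.
exact/gen_commute/adj_sym.
Qed.

Lemma expo_zpow v j : expo v (zpow (gen v) j) = j.
Proof. by rewrite /zpow expoM !expoX expoV expo_gen; lia. Qed.

Lemma commute_genP v a : commute a (gen v) <-> par (star v) a.
Proof.
split=> [av|]; last first.
  move=> sa; apply: (@commute_par _ (star v) (eq v)) sa (par_gen (erefl v)) => x _ [->|vx] <- //.
  exact/gen_commute/adj_sym.
have vj j : commute (zpow (gen v) j) (gen v) by apply/commute_sym/commute_zpow.
rewrite -(mulgVK (zpow (gen v) (expo v a)) a); apply: parM.
  apply: (@par_sub _ (adj v)); first by move=> x; right.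
  apply: commute_gen_expo0; last by rewrite expoM expoV expo_zpow; lia.
  by apply: commute_mull av _; apply/commute_sym/commuteV/commute_sym.
have vv : par (star v) (gen v) by apply: par_gen; left.
by apply: parM; apply: parX => //; apply: parV.
Qed.

Lemma gen_neq1 v : gen v <> 1.
Proof. by move=> /(congr1 (expo v)); rewrite expo_gen expo1. Qed.

Lemma commute_gens_adj x y : commute (gen x) (gen y) -> x = y \/ adj x y.
Proof.
move=> /commute_genP; have [[->|yx]|nyx] := pselect (star y x); [by left|by right; apply: adj_sym|].
by rewrite /par ret_genN // => /esym/gen_neq1.
Qed.

End Centralizers.

(* A letter [v] of exponent 0 in [g] disappears either by passing to
   [unfold v], or, when some element commuting with [g] has nonzero
   [v]-exponent, because [g] is then conjugate to its image in the link of
   [v]. *)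
Lemma centralizer_ind (C : graph -> Prop)
    (Q : forall Gamma : graph, raag Gamma -> raag Gamma -> raag Gamma -> Prop) :
  (forall (Gamma : graph) (v : Gamma), C Gamma -> C (unfold v)) ->
  (forall (Gamma : graph) (v : Gamma) g x y, Q (unfold v) g x y ->
     Q Gamma (fold g) (fold x) (fold y)) ->
  (forall (Gamma : graph) c g x y, Q Gamma (g ^ c) (x ^ c) (y ^ c) -> Q Gamma g x y) ->
  (forall (Gamma : graph) (u : word Gamma) x y, C Gamma ->
     (forall v : Gamma, (v : {classic Gamma}) \in map fst u -> expo v (wd u) <> 0%Z) ->
     commute x (wd u) -> commute y (wd u) -> ~ commute x y -> Q Gamma (wd u) x y) ->
  forall (Gamma : graph) g x y, C Gamma -> commute x g -> commute y g -> ~ commute x y ->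
  Q Gamma g x y.
Proof.
move=> Cunf Qfold Qconj Qbase Gamma g; rewrite -(wd_repr g).
move: (repr g) => {g} u; have [m um] := ubnP (size u).
elim: m Gamma u um => // m IHm Gamma u um x y CG.
set g := wd u => xg yg xy.
have [[v vu v0]|nz] := pselect (exists2 v : Gamma, (v : {classic Gamma}) \in map fst u
    & expo v g = 0%Z); last first.
  by apply: Qbase => // v vu v0; apply: nz; exists v.
have hyp z : commute z g -> expo v z <> 0%Z -> Q Gamma g x y.
  move=> zg z0; have gz := commute_sym zg.
  have [c [_ gc _]] := commute_expo_conj z0 gz gz v0 v0.
  apply: (Qconj _ c); rewrite gc /g ret_wd; apply: IHm => //.
  - exact: leq_trans (size_restrict_lt vu (@adj_irrefl Gamma v)) um.
  - by rewrite -ret_wd -/g -gc commuteJ.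
  - by rewrite -ret_wd -/g -gc commuteJ.
  - by rewrite commuteJ.
have [x0|/(hyp _ xg)//] := pselect (expo v x = 0%Z).
have [y0|/(hyp _ yg)//] := pselect (expo v y = 0%Z).
rewrite -(fold_unfE v0) -(fold_unfE x0) -(fold_unfE y0); apply: Qfold.
rewrite /g unfE_wd; apply: IHm; rewrite -?unfE_wd -/g.
- exact: leq_trans (size_unf_lt 0 vu) um.
- exact: Cunf.
- exact: unfE_commute.
- exact: unfE_commute.
- move=> /(gmulf_commute (@fold _ v)) xyc; apply: xy.
  by rewrite -(fold_unfE x0) -(fold_unfE y0).
Qed.

(** * Induced cycles *)

Definition consec (m i j : nat) :=
  j = i.+1 \/ i = j.+1 \/ (i = 0%N /\ j.+1 = m) \/ (j = 0%N /\ i.+1 = m).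

(** Only the values of [f] below [m] matter; indexing by [nat] makes rotations and subpaths plain
    arithmetic. *)
Definition induced_cycle (Gamma : graph) (m : nat) (f : nat -> Gamma) :=
  forall i j, (i < m)%N -> (j < m)%N -> i <> j ->
    f i <> f j /\ (adj (f i) (f j) <-> consec m i j).

Definition chordal (Gamma : graph) :=
  forall m (f : nat -> Gamma), (4 <= m)%N -> ~ induced_cycle m f.

(* Length 5 being excluded too, this says: bipartite, and every cycle of
   length at least 6 has a chord. *)
Definition chordal_bipartite (Gamma : graph) :=
  forall m (f : nat -> Gamma), m = 3%N \/ (5 <= m)%N -> ~ induced_cycle m f.

(** Otherwise [v], [p], [w], [q] would be an induced square. *)
Lemma chordal_link (Gamma : graph) (v w p q : Gamma) :
  chordal Gamma -> v <> w -> ~ adj v w ->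
  adj v p -> adj w p -> adj v q -> adj w q -> p = q \/ adj p q.
Proof.
move=> CG vw nvw vp wp vq wq; apply: contrapT => /not_orP[pq npq].
apply: (CG 4 (fun i => match i with 0 => v | 1 => p | 2 => w | _ => q end)) => //.
have nb (x y : Gamma) : adj x y -> x <> y by move=> xy xyE; move: xy; rewrite xyE => /adj_irrefl.
have sy (x y : Gamma) : ~ adj x y -> ~ adj y x by move=> nxy /adj_sym.
have [vpn wpn vqn wqn] := And4 (nb _ _ vp) (nb _ _ wp) (nb _ _ vq) (nb _ _ wq).
case=> [|[|[|[|i]]]] [|[|[|[|j]]]] // _ _ _; rewrite /consec; split;
  try solve [by auto | by apply/esym]; split; try solve [by auto | lia];
  by [move=> /sy | move=> /adj_sym | lia| move=> _; apply: adj_sym; auto].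
Qed.

Lemma triangle_free_adj (Gamma : graph) (x y z : Gamma) :
  chordal_bipartite Gamma -> adj x y -> adj y z -> ~ adj x z.
Proof.
move=> CG xy yz xz.
apply: (CG 3 (fun i => match i with 0 => x | 1 => y | _ => z end)); first by left.
have nb (a b : Gamma) : adj a b -> a <> b by move=> ab E; move: ab; rewrite E => /adj_irrefl.
have [yx [zy zx]] := conj (adj_sym xy) (conj (adj_sym yz) (adj_sym xz)).
case=> [|[|[|i]]] [|[|[|j]]] // _ _ _; (split; first exact: nb);
  (split=> // _; rewrite /consec; lia).
Qed.

Section CycleRotation.
Variables (Gamma : graph) (m : nat) (f : nat -> Gamma).

Definition rotate k i := f (if (i + k < m)%N then i + k else i + k - m)%N.

Lemma rotate0 k : (k < m)%N -> rotate k 0 = f k.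
Proof. by move=> km; rewrite /rotate add0n km. Qed.

Lemma rotate_onto k i : (k < m)%N -> (i < m)%N -> exists2 j, (j < m)%N & rotate k j = f i.
Proof.
move=> km im; exists (if (k <= i)%N then i - k else i + m - k)%N; first by case: ifP; lia.
by rewrite /rotate; congr f; do 2!case: ifP; lia.
Qed.

Lemma rotate_cycle k : (k < m)%N -> induced_cycle m f -> induced_cycle m (rotate k).
Proof.
move=> km fC i j im jm ij; rewrite /rotate.
set i' := if _ then _ else _; set j' := if (j + k < m)%N then _ else _.
have [im' jm'] : (i' < m)%N /\ (j' < m)%N by rewrite /i' /j'; do 2!case: ifP; lia.
have [|nf af] := fC i' j' im' jm'; first by rewrite /i' /j'; do 2!case: ifP; lia.
split=> //; rewrite af /consec /i' /j'.
by do 2!case: ifP; lia.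
Qed.

End CycleRotation.

Lemma cycle_nbr (Gamma : graph) m (f : nat -> Gamma) i : (2 <= m)%N ->
  induced_cycle m f -> (i < m)%N -> exists2 j, (j < m)%N & adj (f i) (f j).
Proof.
move=> m2 fC im; have [i1|i1] := ltnP i.+1 m.
  by exists i.+1 => //; have [|_ ->] := fC _ _ im i1; [lia | left].
have m0 : (0 < m)%N by lia.
by exists 0%N => //; have [|_ ->] := fC _ _ im m0; [lia | do 3!right; lia].
Qed.

(** * Cycles in the unfolding *)

Section UnfoldCycle.
Variables (Gamma : graph) (v : Gamma).

Definition linked (p : unfold v) := adj v p.1.
(** Excludes pairs that are isolated in the unfolding: copies of [v], and link vertices at nonzero
    level. *)
Definition proper_vertex (p : unfold v) := p.1 <> v /\ (linked p -> p.2 = 0%Z).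

Lemma proper_adj (p q : unfold v) : adj p q -> proper_vertex p /\ proper_vertex q.
Proof. by case=> _ [? ?] *; split. Qed.

Lemma unfold_adjP (p q : unfold v) : proper_vertex p -> proper_vertex q ->
  (~ linked p -> ~ linked q -> p.2 = q.2) -> (adj p q <-> adj p.1 q.1).
Proof. by move=> [pv p0] [qv q0] pq; split=> [[]|pq1]. Qed.

Lemma unfold_eqP (p q : unfold v) : proper_vertex p -> proper_vertex q ->
  (~ linked p -> ~ linked q -> p.2 = q.2) -> p.1 = q.1 -> p = q.
Proof.
case: p q => [x i] [y j] [_ /= p0] [_ /= q0] pq xy; rewrite -xy in q0 pq *.
congr pair; have [vx|nvx] := pselect (adj v x); last exact: pq.
by rewrite p0 // q0.
Qed.

Variables (m : nat) (f : nat -> unfold v).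
Hypotheses (m3 : (3 <= m)%N) (fC : induced_cycle m f).

Lemma cycle_proper i : (i < m)%N -> proper_vertex (f i).
Proof.
move=> im; have [|j _ /proper_adj[]//] := cycle_nbr _ fC im; lia.
Qed.

Lemma fst_cycle :
  (forall i j, (i < m)%N -> (j < m)%N -> ~ linked (f i) -> ~ linked (f j) ->
     (f i).2 = (f j).2) ->
  induced_cycle m (fun i => (f i).1).
Proof.
move=> lvl i j im jm ij; have [nf af] := fC im jm ij.
have [pi pj] := (cycle_proper im, cycle_proper jm).
split; first by move=> /(unfold_eqP pi pj (lvl _ _ im jm)).
by rewrite -af unfold_adjP //; apply: lvl.
Qed.

Lemma level_const l r : (r <= m)%N ->
  (forall t, (l <= t < r)%N -> ~ linked (f t)) ->
  forall t, (l <= t < r)%N -> (f t).2 = (f l).2.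
Proof.
move=> rm nl; elim=> [|t IHt] ltr; first by congr (f _).2; lia.
have [->//|lt] := eqVneq l t.+1; rewrite -IHt; last lia.
have [tm tm1] : (t < m)%N /\ (t.+1 < m)%N by lia.
have /(_ (or_introl erefl)) [_ _ _ _ E] := (fC tm tm1 (n_Sn t)).2.2.
by apply/esym/E; apply: nl; lia.
Qed.

(** The inner vertices stay on one level, so the segment projects to an induced path, of which [v]
    sees only the two ends. The bound [1 <= l] rules out the wrap-around edge. *)
Lemma short_cycle l r : (1 <= l)%N -> (l + 2 <= r)%N -> (r < m)%N ->
  linked (f l) -> linked (f r) -> (forall t, (l < t < r)%N -> ~ linked (f t)) ->
  induced_cycle (r - l).+2 (fun i => if i is k.+1 then (f (l + k)%N).1 else v).
Proof.
move=> l1 lr rm fl fr nl.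
have lvl t : (l < t < r)%N -> (f t).2 = (f l.+1).2.
  by move=> ltr; apply: (@level_const l.+1 r) => //; lia.
have link t : (l <= t <= r)%N -> linked (f t) <-> t = l \/ t = r.
  move=> ltr; split=> [ft|[]->//]; apply: contrapT => /not_orP[tl tr].
  by apply: (nl t) ft; lia.
have nv t : (l <= t <= r)%N -> (f t).1 <> v.
  by move=> ltr; have [|] := @cycle_proper t; [lia|].
have vtx i : (i < (r - l).+1)%N -> v <> (f (l + i)%N).1 /\
    (adj v (f (l + i)%N).1 <-> consec (r - l).+2 0 i.+1).
  move=> ir; split; first by move=> /esym; apply: nv; lia.
  by have := link (l + i)%N; rewrite /linked => ->; rewrite ?/consec; lia.
case=> [|i] [|j] // im jm ij.
- by apply: vtx.
- have [|vi ai] := vtx i; first lia.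
  split; first by move/esym.
  split=> [/adj_sym/ai|c]; first by rewrite /consec; lia.
  by apply/adj_sym/ai; move: c; rewrite /consec; lia.
- have [im' jm'] : (l + i < m)%N /\ (l + j < m)%N by lia.
  have [|nf af] := fC im' jm'; first lia.
  have [pi pj] := (cycle_proper im', cycle_proper jm').
  have lv : ~ linked (f (l + i)%N) -> ~ linked (f (l + j)%N) ->
      (f (l + i)%N).2 = (f (l + j)%N).2.
    by rewrite !link; [move=> ni nj; rewrite !lvl //; lia | lia..].
  split; first by move=> /(unfold_eqP pi pj lv).
  by rewrite -unfold_adjP // af /consec; lia.
Qed.

(** Both arcs from [f i] to [f 0] change level, hence meet the link; [l] and [r] are the linked
    indices closest to [i] on either side. *)
Lemma unlinked_run i : ~ linked (f 0) -> (i < m)%N -> ~ linked (f i) ->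
  (f i).2 <> (f 0).2 ->
  exists l r, [/\ (1 <= l < i)%N, (i < r < m)%N, linked (f l), linked (f r) &
    forall t, (l < t < r)%N -> ~ linked (f t)].
Proof.
move=> f0 im fi fi0.
pose L l := (l < i)%N && `[< linked (f l) >].
pose R r := (i < r < m)%N && `[< linked (f r) >].
have [exL|noL] := pselect (exists l, L l); last first.
  case: fi0; apply: (@level_const 0 i.+1) => // [t ti|]; last lia.
  have [->//|ti'] := eqVneq t i.
  by move=> ft; apply: noL; exists t; apply/andP; split; [lia | exact/asboolP].
have [exR|noR] := pselect (exists r, R r); last first.
  case: fi0; have nR t : (i <= t < m)%N -> ~ linked (f t).
    move=> tim; have [->//|ti] := eqVneq t i.
    by move=> ft; apply: noR; exists t; apply/andP; split; [lia | exact/asboolP].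
  (* The level persists up to [m.-1], and the closing edge carries it to index 0. *)
  have <- : (f m.-1).2 = (f i).2 by apply: (@level_const i m) => //; lia.
  have [m1 m0] : (m.-1 < m)%N /\ (0 < m)%N by lia.
  have [|_ [_ ad]] := fC m1 m0; first lia.
  have [|_ _ _ _ E] := ad; first by do 3!right; lia.
  by apply: E => //; apply: nR; lia.
have Lb l : L l -> (l <= i)%N by move=> /andP[]; lia.
case: (ex_maxnP exL Lb) => l /andP[li /asboolP fl] lmax.
case: (ex_minnP exR) => r /andP[ir /asboolP fr] rmin.
exists l, r; split=> //.
- by case: l li fl {lmax} => // _ /f0.
- move=> t ltr ft; have [ti|it|ti] := ltngtP t i.
  + have /lmax : L t by apply/andP; split; [|exact/asboolP].
    by lia.
  + have /rmin : R t by apply/andP; split; [lia|exact/asboolP].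
    by lia.
  + by apply: fi; rewrite -ti.
Qed.

End UnfoldCycle.

(** If all unlinked vertices share a level, the cycle projects to an induced one. Otherwise one of
    two vertices at different levels is rotated to index 0, and [v] closes the run around the other
    into an induced cycle of length at least 4. *)
Lemma chordal_unfold (Gamma : graph) (v : Gamma) : chordal Gamma -> chordal (unfold v).
Proof.
move=> CG m f m4 fC; have m3 : (3 <= m)%N by lia.
apply: (CG _ _ m4 (fst_cycle m3 fC _)) => i k im km fi fk.
apply: contrapT => fik.
have gC := rotate_cycle km fC; have [j jm gj] := rotate_onto f km im.
have g0 : ~ linked (rotate m f k 0) by rewrite rotate0.
have gj0 : ~ linked (rotate m f k j) by rewrite gj.
have lv : (rotate m f k j).2 <> (rotate m f k 0).2 by rewrite rotate0 // gj.
have [l [r [l1 r1 gl gr nl]]] := unlinked_run m3 gC g0 jm gj0 lv.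
by apply: (CG _ _ _ (short_cycle m3 gC _ _ _ gl gr nl)); lia.
Qed.

(** Without triangles the walk has distinct vertices and no chord, so it would be an induced
    pentagon. *)
Lemma no_closed_5walk (Gamma : graph) (a b c d e : Gamma) : chordal_bipartite Gamma ->
  adj a b -> adj b c -> adj c d -> adj d e -> ~ adj e a.
Proof.
move=> CG ab bc cd de ea.
have T3 := triangle_free_adj CG.
have [nac nbd nce] := And3 (T3 _ _ _ ab bc) (T3 _ _ _ bc cd) (T3 _ _ _ cd de).
have [nda neb] := conj (T3 _ _ _ de ea) (T3 _ _ _ ea ab).
have nb (x y : Gamma) : adj x y -> x <> y by move=> xy E; move: xy; rewrite E => /adj_irrefl.
have sy (x y : Gamma) : ~ adj x y -> ~ adj y x by move=> nxy /adj_sym.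
have neq (x y z : Gamma) : ~ adj x z -> adj y z -> x <> y by move=> nxz yz E; apply: nxz; rewrite E.
apply: (CG 5 (fun i => match i with 0 => a | 1 => b | 2 => c | 3 => d | _ => e end)).
  by right.
have [[ba cb dc] [ed ae]] :=
  conj (And3 (adj_sym ab) (adj_sym bc) (adj_sym cd)) (conj (adj_sym de) (adj_sym ea)).
have [[nca ndb nec] [nad nbe]] := conj (And3 (sy _ _ nac) (sy _ _ nbd) (sy _ _ nce))
  (conj (sy _ _ nda) (sy _ _ neb)).
have [[xac xbd xce] [xda xeb]] := conj (And3 (neq a c d nad cd) (neq b d e nbe de)
  (neq c e a nca ea)) (conj (neq d a b ndb ab) (neq e b c nec bc)).
have [[xca xdb xec] [xad xbe]] := conj (And3 (nesym xac) (nesym xbd) (nesym xce))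
  (conj (nesym xda) (nesym xeb)).
case=> [|[|[|[|[|i]]]]] [|[|[|[|[|j]]]]] // _ _ _; (split; first by [|apply: nb]);
  (split=> //; rewrite /consec; lia).
Qed.

(** The cycle given by [short_cycle] has at least 4 vertices, and only length 4 is allowed: the run
    consists of [f i] alone. *)
Lemma chordal_bipartite_run (Gamma : graph) (v : Gamma) m (f : nat -> unfold v) i :
  chordal_bipartite Gamma -> (3 <= m)%N -> induced_cycle m f ->
  ~ linked (f 0) -> (i < m)%N -> ~ linked (f i) -> (f i).2 <> (f 0).2 ->
  [/\ (2 <= i)%N, (i.+1 < m)%N, linked (f i.-1) & linked (f i.+1)].
Proof.
move=> CG m3 fC f0 im fi fi0.
have [l [r [li ir fl fr nl]]] := unlinked_run m3 fC f0 im fi fi0.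
have [lE rE] : l = i.-1 /\ r = i.+1.
  apply: contrapT => lr; apply: (CG _ _ _ (short_cycle m3 fC _ _ _ fl fr nl)); [right|..]; lia.
by split; rewrite -?lE -?rE //; lia.
Qed.

Lemma chordal_bipartite_levels (Gamma : graph) (v : Gamma) m (f : nat -> unfold v) i :
  chordal_bipartite Gamma -> m = 3%N \/ (5 <= m)%N -> induced_cycle m f ->
  ~ linked (f 0) -> (i < m)%N -> ~ linked (f i) -> (f i).2 <> (f 0).2 ->
  (f i).1 <> (f 0).1 /\ ~ adj (f i).1 (f 0).1.
Proof.
move=> CG mP fC f0 im fi fi0; have m3 : (3 <= m)%N by lia.
have [i2 i1m fp fs] := chordal_bipartite_run CG m3 fC f0 im fi fi0.
have [m0 m1 pm] : [/\ (0 < m)%N, (1 < m)%N & (i.-1 < m)%N] by split; lia.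
have adjE a b : (a < m)%N -> (b < m)%N -> a <> b -> linked (f b) ->
    adj (f a).1 (f b).1 <-> consec m a b.
  move=> am bm ab fb; have [_ <-] := fC a b am bm ab.
  have [pa pb] := (cycle_proper m3 fC am, cycle_proper m3 fC bm).
  by rewrite unfold_adjP.
split=> [E|adj0].
  (* With equal projections, index 0 inherits both neighbours of [i], which forces [i = 2] and
     [m = 4]. *)
  suff [] : consec m 0 i.-1 /\ consec m 0 i.+1 by rewrite /consec; lia.
  split; apply/adjE => //; try lia; rewrite -E; apply/adjE => //; rewrite /consec; lia.
(* Rotating [i] to index 0 moves [f 0] to index [m - i], and [chordal_bipartite_run] then says that
   its successor [f 1] is linked. *)
have gC := rotate_cycle im fC; have g0 := rotate0 f im.
have gi : rotate m f i (m - i) = f 0%N by rewrite /rotate; case: ifP => [|_]; [lia | congr f; lia].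
have h0 : ~ linked (rotate m f i 0) by rewrite g0.
have hi : ~ linked (rotate m f i (m - i)) by rewrite gi.
have lv : (rotate m f i (m - i)).2 <> (rotate m f i 0).2 by rewrite gi g0 => /esym.
have [|_ _ _] := chordal_bipartite_run CG m3 gC h0 _ hi lv; first lia.
rewrite (_ : rotate m f i (m - i).+1 = f 1%N) => [f1|]; last first.
  by rewrite /rotate; case: ifP => [|_]; [lia | congr f; lia].
(* The walk visits [v] and the projections of [f i.+1], [f i], [f 0], [f 1]. *)
apply: (no_closed_5walk CG fs _ adj0 _ (adj_sym f1)).
- by apply/adj_sym/adjE => //; rewrite /consec; lia.
- by apply/adjE => //; rewrite /consec; lia.
Qed.

(** Levels may differ along the cycle, yet its projection is induced: by [chordal_bipartite_levels]
    no edge or coincidence appears between unlinked vertices of different levels. *)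
Lemma chordal_bipartite_unfold (Gamma : graph) (v : Gamma) :
  chordal_bipartite Gamma -> chordal_bipartite (unfold v).
Proof.
move=> CG m f mP fC; have m3 : (3 <= m)%N by lia.
apply: (CG _ (fun i => (f i).1) mP) => i k im km ik.
have [nf af] := fC i k im km ik.
have [pi pk] := (cycle_proper m3 fC im, cycle_proper m3 fC km).
have [lvl|/not_implyP[fi /not_implyP[fk fik]]] :=
  pselect (~ linked (f i) -> ~ linked (f k) -> (f i).2 = (f k).2).
  split; first by move=> /(unfold_eqP pi pk lvl).
  by rewrite -unfold_adjP.
have gC := rotate_cycle km fC; have [j jm gj] := rotate_onto f km im.
have g0 : ~ linked (rotate m f k 0) by rewrite rotate0.
have gj0 : ~ linked (rotate m f k j) by rewrite gj.
have lv : (rotate m f k j).2 <> (rotate m f k 0).2 by rewrite rotate0 // gj.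
have := chordal_bipartite_levels CG mP gC g0 jm gj0 lv.
rewrite rotate0 // gj => -[ne na].
by split=> //; rewrite -af; split=> [/na|[]].
Qed.

(** * Adding a vertex *)

Section AddVertex.
Variables (Gamma : graph) (T : Gamma -> Prop).

Definition add_adj (p q : option Gamma) : Prop :=
  match p, q with
  | Some x, Some y => adj x y
  | Some x, None | None, Some x => T x
  | None, None => False
  end.

Fact add_adj_sym p q : add_adj p q -> add_adj q p.
Proof. by case: p => [x|]; case: q => [y|] //=; apply: adj_sym. Qed.

Fact add_adj_irrefl p : ~ add_adj p p.
Proof. by case: p => [x|] //=; apply: adj_irrefl. Qed.

(* [None] is a new vertex with set of neighbours [T]. *)
Definition add_vertex : graph := Graph add_adj_sym add_adj_irrefl.

Lemma add_vertex_cycle m (f : nat -> add_vertex) : (3 <= m)%N -> induced_cycle m f ->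
  (exists g : nat -> Gamma, induced_cycle m g) \/
  exists g : nat -> Gamma,
    (forall i j, (1 <= i < m)%N -> (1 <= j < m)%N -> i <> j ->
       g i <> g j /\ (adj (g i) (g j) <-> j = i.+1 \/ i = j.+1)) /\
    (forall i, (1 <= i < m)%N -> T (g i) <-> i = 1%N \/ i.+1 = m).
Proof.
move=> m3 fC; have [[k km fk]|none] := pselect (exists2 k, (k < m)%N & f k = None).
  right; have := rotate_cycle km fC; set h := rotate m f k => hC.
  have h0 : h 0%N = None by rewrite /h rotate0.
  have m0 : (0 < m)%N by lia.
  have hS i : (1 <= i < m)%N -> exists x, h i = Some x.
    move=> im; have [||] := hC i 0%N _ m0; [lia | lia |].
    by rewrite h0; case: (h i) => // x _ _; exists x.
  have [x0 _] := hS 1%N ltac:(lia).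
  pose g i := odflt x0 (h i).
  have hg i : (1 <= i < m)%N -> h i = Some (g i) by rewrite /g => /hS[x ->].
  exists g; split=> [i j im jm ij|i im].
    have [||nh ah] := hC i j _ _ ij; [lia | lia |].
    move: nh ah; rewrite !hg // => nh ah; split; first by move=> gE; apply: nh; rewrite gE.
    by apply: iff_trans ah _; rewrite /consec; lia.
  have [||_] := hC i 0%N _ m0; [lia | lia |].
  by rewrite h0 hg // => ah; apply: iff_trans ah _; rewrite /consec; lia.
left; have hS i : (i < m)%N -> exists x, f i = Some x.
  by case E : (f i) => [x|] im; [exists x | case: none; exists i].
have [x0 _] := hS 0%N ltac:(lia).
pose g i := odflt x0 (f i).
have hg i : (i < m)%N -> f i = Some (g i) by rewrite /g => /hS[x ->].
exists g => i j im jm ij; have [nf af] := fC i j im jm ij.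
move: nf af; rewrite !hg // => nf af; split=> //.
by move=> gE; apply: nf; rewrite gE.
Qed.

End AddVertex.

Lemma close_path (Gamma : graph) (g : nat -> Gamma) m M s : (M < m)%N ->
  (forall i j, (1 <= i < m)%N -> (1 <= j < m)%N -> i <> j ->
     g i <> g j /\ (adj (g i) (g j) <-> j = i.+1 \/ i = j.+1)) ->
  (forall i, (1 <= i <= M)%N -> s <> g i /\ (adj s (g i) <-> i = 1%N \/ i = M)) ->
  induced_cycle M.+1 (fun i => if i is 0 then s else g i).
Proof.
move=> Mm gP sP; case=> [|i] [|j] // im jm ij.
- have [|ns ->] := sP j.+1; first lia.
  by split=> //; rewrite /consec; lia.
- have [|ns as_] := sP i.+1; first lia.
  split; first by move/esym.
  split=> [/adj_sym/as_|c]; first by rewrite /consec; lia.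
  by apply/adj_sym/as_; move: c; rewrite /consec; lia.
- have [|||ng ->] := gP i.+1 j.+1; [lia | lia | lia |].
  by split=> //; rewrite /consec; lia.
Qed.

(* Closing the path at the first neighbour of [s] beyond [g 2]. *)
Lemma fan_cycle (Gamma : graph) (g : nat -> Gamma) m s : (4 <= m)%N ->
  (forall i j, (1 <= i < m)%N -> (1 <= j < m)%N -> i <> j ->
     g i <> g j /\ (adj (g i) (g j) <-> j = i.+1 \/ i = j.+1)) ->
  (forall i, (1 <= i < m)%N -> s <> g i) ->
  adj s (g 1%N) -> ~ adj s (g 2) -> adj s (g m.-1) ->
  exists M, [/\ (3 <= M < m)%N, adj s (g M) &
    induced_cycle M.+1 (fun i => if i is 0 then s else g i)].
Proof.
move=> m4 gP sg s1 s2 sm.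
pose P M := (3 <= M < m)%N && `[< adj s (g M) >].
have m1 : m.-1 <> 2 by move=> mE; apply: s2; rewrite -mE.
have exP : exists M, P M by exists m.-1; apply/andP; split; [lia | exact/asboolP].
case: (ex_minnP exP) => M /andP[M3 /asboolP sM] Mmin; exists M; split=> //.
apply: (@close_path _ _ m) => // [|i iM]; first lia.
split; first by apply: sg; lia.
split=> [si|[->|->]//]; apply: contrapT => /not_orP[i1 iM'].
have [i2|i2] := eqVneq i 2; first by apply: s2; rewrite -i2.
have : P i by apply/andP; split; [lia | exact/asboolP].
by move=> /Mmin; lia.
Qed.

(** In a cycle through the new vertex, no other vertex lies in [K]: an end of the remaining path
    would be equal or adjacent to the other end, and an inner vertex would be in the common star.
    Some [k] in [K] misses [g 2], and [fan_cycle] at [k] gives a cycle of length at least 4. *)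
Lemma chordal_add (Gamma : graph) (K : Gamma -> Prop) :
  chordal Gamma -> (forall p q, K p -> K q -> p = q \/ adj p q) ->
  chordal (add_vertex (fun x => forall k, K k -> star k x)).
Proof.
move=> CG Kc m f m4 fC; have m3 : (3 <= m)%N by lia.
have [[g]|[g [gP gT]]] := add_vertex_cycle m3 fC; first exact: CG.
have [b1 bm] : (1 <= 1 < m)%N /\ (1 <= m.-1 < m)%N by lia.
have /(gT _ b1) T1 : 1%N = 1%N \/ 2 = m by left.
have /(gT _ bm) Tm : m.-1 = 1%N \/ m.-1.+1 = m by right; lia.
have [|n1m a1m] := gP _ _ b1 bm; first lia.
have {}a1m : ~ adj (g 1%N) (g m.-1) by rewrite a1m; lia.
have nKT i : (1 <= i < m)%N -> ~ K (g i).
  move=> im Ki; have [i1|i1] := eqVneq i 1%N.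
    by move: Ki; rewrite i1 => /Tm[/esym//|].
  have [iE|iE] := eqVneq i m.-1.
    by move: Ki; rewrite iE => /T1[//|/adj_sym].
  suff /(gT _ im) : forall k, K k -> star k (g i) by lia.
  by move=> k Kk; have [->|] := Kc _ _ Kk Ki; [left|right].
have b2 : (1 <= 2 < m)%N by lia.
have : ~ (forall k, K k -> star k (g 2)) by move=> /(gT _ b2); lia.
move=> /existsNP[k /not_implyP[Kk /not_orP[_ nk2]]].
have kg i : (1 <= i < m)%N -> k <> g i by move=> im kE; apply: (nKT _ im); rewrite -kE.
have kadj i : (1 <= i < m)%N -> star k (g i) -> adj k (g i).
  by move=> im [/esym/(kg _ im)|].
have [M [M3 _]] := fan_cycle m4 gP kg (kadj _ b1 (T1 _ Kk)) nk2 (kadj _ bm (Tm _ Kk)).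
by apply: CG; lia.
Qed.

(** Each [s] in [S] is adjacent to [g 1], hence not to [g 2], and its fan cycle must have length 4.
    So [g 3] is adjacent to all of [S], although it is an inner vertex of the path when [m >= 5]. *)
Lemma chordal_bipartite_add (Gamma : graph) (S : Gamma -> Prop) s0 :
  chordal_bipartite Gamma -> S s0 ->
  chordal_bipartite (add_vertex (fun x => forall s, S s -> adj s x)).
Proof.
move=> CG S0 m f mP fC; have m3 : (3 <= m)%N by lia.
have [[g]|[g [gP gT]]] := add_vertex_cycle m3 fC; first exact: CG.
have [b1 [b2 bm]] : (1 <= 1 < m)%N /\ (1 <= 2 < m)%N /\ (1 <= m.-1 < m)%N by lia.
have /(gT _ b1) T1 : 1%N = 1%N \/ 2 = m by left.
have /(gT _ bm) Tm : m.-1 = 1%N \/ m.-1.+1 = m by right; lia.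
have [//|_ [_ /(_ (or_introl erefl)) g12]] := gP _ _ b1 b2.
have ns2 s : S s -> ~ adj s (g 2).
  by move=> Ss; apply: (triangle_free_adj CG _ g12); apply: T1.
case: mP => [mE|m5].
  by apply: (ns2 _ S0); move: (Tm _ S0); rewrite mE.
have b3 : (1 <= 3 < m)%N by lia.
suff /(gT _ b3) : forall s, S s -> adj s (g 3) by lia.
move=> s Ss; have sg i : (1 <= i < m)%N -> s <> g i.
  move=> im sE; have [i1|i1] := eqVneq i 1%N.
    by move: (T1 _ Ss); rewrite sE i1 => /adj_irrefl.
  have [iE|iE] := eqVneq i m.-1.
    by move: (Tm _ Ss); rewrite sE iE => /adj_irrefl.
  have [|_ a1] := gP _ _ im b1; first lia.
  have [|_ am] := gP _ _ im bm; first lia.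
  by move: (T1 _ Ss) (Tm _ Ss); rewrite sE a1 am; lia.
have m4 : (4 <= m)%N by lia.
have [M [M3 sM MC]] := fan_cycle m4 gP sg (T1 _ Ss) (ns2 _ Ss) (Tm _ Ss).
suff <- : M = 3%N by [].
by apply: contrapT => M3'; apply: (CG _ _ _ MC); lia.
Qed.

Lemma cycle_adj_consec m (a b : 'I_m) : cycle_adj a b <-> a <> b /\ consec m a b.
Proof.
have ordSE (c d : 'I_m) : d = ordS c <-> d = c.+1 :> nat \/ (d = 0%N :> nat /\ c.+1 = m).
  have -> : d = ordS c <-> d = c.+1 %% m :> nat by split=> [->|E] //; apply: val_inj.
  have [cm|cm] := ltnP c.+1 m; first by rewrite modn_small //; lia.
  have cm' : c.+1 = m by have := ltn_ord c; lia.
  by rewrite cm' modnn; have := ltn_ord d; lia.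
by rewrite /cycle_adj !ordSE /consec; split=> -[ab c]; split=> //; lia.
Qed.

Lemma induced_cycle_contains (Gamma : graph) m (f : nat -> Gamma) :
  induced_cycle m f -> contains_induced (cycle_graph m) Gamma.
Proof.
move=> fC; have neqN (i j : 'I_m) : i <> j -> i <> j :> nat.
  by move=> ij E; apply/ij/val_inj.
exists (fun i : 'I_m => f i); split=> [i j fij|i j].
  apply: contrapT => ij; have [nf _] := fC i j (ltn_ord i) (ltn_ord j) (neqN _ _ ij).
  exact: nf.
have [->|/eqP ij] := eqVneq i j; first by split=> /adj_irrefl.
have [_ ->] := fC i j (ltn_ord i) (ltn_ord j) (neqN _ _ ij).
by apply: iff_sym; apply: (iff_trans (cycle_adj_consec i j)); split=> [[]|].
Qed.

(** * Elements with nonabelian centralizer *)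

Section CentralizerStructure.

Lemma parT (Gamma : graph) (S : Gamma -> Prop) (a : raag Gamma) : (forall x, S x) -> par S a.
Proof.
move=> St; apply: (@par_sub _ (fun l => exists2 m, m \in repr a & m.1 = l :> Gamma)) => //.
by rewrite -[a in par _ a]wd_repr; apply: par_wd => l la; exists l.
Qed.

Lemma par_all (Gamma : graph) (R : Gamma -> Gamma -> Prop) (s : seq {classic Gamma})
    (a : raag Gamma) :
  (forall w, w \in s -> par (R w) a) -> par (fun x => forall w, w \in s -> R w x) a.
Proof.
elim: s => [|w s IHs] Rs; first exact: parT.
apply: par_sub (parI (Rs w (mem_head _ _)) (IHs _)) => [x [Rw Rx] y|y ys].
  by rewrite inE => /orP[/eqP->//|/Rx].
by apply: Rs; rewrite inE ys orbT.
Qed.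

(** Undoes [balance]: the powers of [g] commute with both products, and [commute_root] removes the
    exponents. *)
Lemma commute_balanced (Gamma : graph) (g x y : raag Gamma) k m n k' m' n' :
  commute x g -> commute y g ->
  commute (x ^+ k.+1 * (g ^+ m / g ^+ n)) (y ^+ k'.+1 * (g ^+ m' / g ^+ n')) ->
  commute x y.
Proof.
move=> xg yg xy; apply: (@commute_root _ _ _ k); apply/commute_sym.
apply: (@commute_root _ _ _ k'); apply/commute_sym.
apply: (@commute_cancelr _ _ (g ^+ m / g ^+ n)); last first.
  exact/commute_sym/commute_divX/commute_Xl.
apply: commute_sym; apply: (@commute_cancelr _ _ (g ^+ m' / g ^+ n')); first exact: commute_sym.
apply: commuteM; first exact/commute_sym/commute_divX/commute_Xl.
by apply/commute_divX/commute_sym/commute_divX.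
Qed.

Lemma commute_mulX (Gamma : graph) (g x : raag Gamma) k m n :
  commute x g -> commute (x ^+ k.+1 * (g ^+ m / g ^+ n)) g.
Proof.
move=> xg; apply: commute_mull; first exact: commute_Xl.
exact/commute_sym/commute_divX.
Qed.

Lemma fold_genK (Gamma : graph) (v : Gamma) (p : unfold v) j :
  adj v p.1 \/ p.2 = j -> fold_gen p ^ zpow (gen v) j = gen p.1.
Proof.
case: p => w i /= [vw|->]; first by rewrite (fold_gen_link i j vw) conjgKV.
by rewrite /fold_gen conjgKV.
Qed.

Lemma par_fold_conj (Gamma : graph) (v : Gamma) (S : unfold v -> Prop) (T : Gamma -> Prop) d a :
  (forall p, S p -> par T (fold_gen p ^ d)) -> par S a -> par T (fold a ^ d).
Proof.
move=> ST; apply: (@par_ind _ S (fun a => par T (fold a ^ d))) => [|b c|b|p Sp].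
- by rewrite fold1 conj1g; apply: par1.
- by rewrite foldM conjMg; apply: parM.
- by rewrite foldV conjVg; apply: parV.
- by rewrite [fold _]raag_lift_gen; apply: ST.
Qed.

(** In the base case, if letters [v], [w] of [g] were distinct and nonadjacent, balanced versions of
    [x] and [y] would be simultaneously conjugate into the subgroup of their common link. By
    [chordal_link] that is a clique, so [x] and [y] would commute. *)
Lemma chordal_centralizer (Gamma : graph) (g x y : raag Gamma) :
  chordal Gamma -> commute x g -> commute y g -> ~ commute x y ->
  exists c (K : Gamma -> Prop), (forall p q, K p -> K q -> p = q \/ adj p q) /\ par K (g ^ c).
Proof.
pose Q (Gamma : graph) (g x y : raag Gamma) := exists c (K : Gamma -> Prop),
  (forall p q, K p -> K q -> p = q \/ adj p q) /\ par K (g ^ c).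
move: Gamma g x y; apply: (@centralizer_ind chordal Q).
- exact: chordal_unfold.
- move=> Gamma v g x y [c [K [Kc Kg]]].
  pose L (w : Gamma) := exists j, K (w, j).
  (* Unlinked members of a clique share their level, so one power of [v] brings them all down to
     [Gamma]. *)
  have [j Kj] : exists j, forall p, K p -> adj v p.1 \/ p.2 = j.
    have [[p Kp np]|none] := pselect (exists2 p, K p & ~ adj v p.1); last first.
      by exists 0%Z => p Kp; left; apply: contrapT => np; apply: none; exists p.
    exists p.2 => q Kq; have [vq|nq] := pselect (adj v q.1); first by left.
    by right; have [->//|[_ _ _ _ ->]] := Kc _ _ Kp Kq.
  exists (fold c * zpow (gen v) j), L; split.
    move=> p q [i Kp] [k Kq]; have [[-> _]|] := Kc _ _ Kp Kq; first by left.
    by case=> /=; right.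
  rewrite conjgM -foldJ; apply: par_fold_conj Kg => p Kp.
  by rewrite fold_genK; [apply: par_gen; exists p.2; case: p Kp | apply: Kj].
- by move=> Gamma c g x y [d [K [Kc Kg]]]; exists (c * d), K; rewrite conjgM.
move=> Gamma u x y CG nz; set g := wd u => xg yg xy.
exists 1, (fun w => (w : {classic Gamma}) \in map fst u); split; last first.
  rewrite conjg1; apply: par_wd => l lu; exact: map_f.
move=> v w vu wu; apply: contrapT => /not_orP[vw nvw]; apply: xy.
have [k [m [n]]] := balance x (nz _ vu); set x' := _ * _ => x0.
have [k' [m' [n']]] := balance y (nz _ vu); set y' := _ * _ => y0.
have x'g : commute x' g by apply: commute_mulX.
have y'g : commute y' g by apply: commute_mulX.
apply: (@commute_balanced _ _ _ _ k m n k' m' n' xg yg); rewrite -/g -/x' -/y'.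
have [c [_ xc yc]] := commute_expo_conj (nz _ vu) x'g y'g x0 y0.
have xw : expo w x' = 0%Z by rewrite -(expoJ _ _ c) xc; apply: expo_ret_out.
have yw : expo w y' = 0%Z by rewrite -(expoJ _ _ c) yc; apply: expo_ret_out.
have [d [_ xd yd]] := commute_expo_conj (nz _ wu) x'g y'g xw yw.
have main z : z ^ c = ret (adj v) z -> z ^ d = ret (adj w) z ->
    z ^ c = (ret (adj v) (ret (adj w) z)) ^ ret (adj v) (d^-1 * c).
  move=> zc zd; rewrite -retJ -zd -conjgM mulVKg zc.
  by apply/esym/par_ret.
rewrite -(commuteJ c) (main x') // (main y') // commuteJ.
rewrite !retI; apply: (commute_par _ (par_ret _ _) (par_ret _ _)) => p q [vp wp] [vq wq].
have [->//|/gen_commute//] := chordal_link CG vw nvw vp wp vq wq.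
Qed.

Definition complete_to (Gamma : graph) (S T : Gamma -> Prop) :=
  forall s t, S s -> T t -> adj s t.

(** Some positive power of [a] lies in the subgroup of [T] up to a power of [g], which is split
    between the two sides to keep exponents natural. *)
Definition par_mod (Gamma : graph) (T : Gamma -> Prop) (g a : raag Gamma) :=
  exists b k m n, par T b /\ a ^+ k.+1 * g ^+ m = b * g ^+ n.

(** [fold_gen] conjugates by powers of [v]. If one set lies in the link, [v] may join the other one;
    if neither does, completeness puts all unlinked vertices on one level, which a power of [v]
    brings down. *)
Lemma fold_complete (Gamma : graph) (v : Gamma) (S T : unfold v -> Prop) :
  complete_to S T -> exists j (S' T' : Gamma -> Prop), [/\ complete_to S' T',
    forall p, S p -> par S' (fold_gen p ^ zpow (gen v) j) &
    forall p, T p -> par T' (fold_gen p ^ zpow (gen v) j)].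
Proof.
have conjv (U : Gamma -> Prop) (p : unfold v) : U v -> U p.1 -> par U (fold_gen p ^ zpow (gen v) 0).
  move=> Uv Up; rewrite zpow0 conjg1; apply: parJ; first exact: par_gen.
  by apply/parV/parM; apply: parX; [|apply: parV]; apply: par_gen.
pose im (U : unfold v -> Prop) (w : Gamma) := exists j, U (w, j).
have im_gen (U : unfold v -> Prop) p j : U p -> adj v p.1 \/ p.2 = j ->
    par (im U) (fold_gen p ^ zpow (gen v) j).
  by move=> Up pj; rewrite fold_genK //; apply: par_gen; exists p.2; case: p Up {pj}.
move=> ST.
have [[q Tq nq]|Tlink] := pselect (exists2 q, T q & ~ adj v q.1); last first.
  have {}Tlink p : T p -> adj v p.1.
    by move=> Tp; apply: contrapT => np; apply: Tlink; exists p.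
  exists 0%Z, (fun w => w = v \/ im S w), (im T); split.
  - move=> s t [->|[i Si]] [j Tj]; first exact: Tlink Tj.
    by have [] := ST _ _ Si Tj.
  - move=> p Sp; apply: conjv; first by left.
    by right; exists p.2; case: p Sp.
  - by move=> p Tp; apply: im_gen => //; left; apply: Tlink.
have [[p Sp np]|Slink] := pselect (exists2 p, S p & ~ adj v p.1); last first.
  have {}Slink p : S p -> adj v p.1.
    by move=> Sp; apply: contrapT => np; apply: Slink; exists p.
  exists 0%Z, (im S), (fun w => w = v \/ im T w); split.
  - move=> s t [i Si] [->|[j Tj]]; first exact/adj_sym/(Slink _ Si).
    by have [] := ST _ _ Si Tj.
  - by move=> r Sr; apply: im_gen => //; left; apply: Slink.
  - move=> r Tr; apply: conjv; first by left.
    by right; exists r.2; case: r Tr.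
have pq : p.2 = q.2 by have [_ _ _ _ ->] := ST _ _ Sp Tq.
exists p.2, (im S), (im T); split.
- by move=> s t [i Si] [j Tj]; have [] := ST _ _ Si Tj.
- move=> r Sr; apply: im_gen => //; have [vr|nr] := pselect (adj v r.1); [by left|right].
  by rewrite pq; have [_ _ _ _ ->] := ST _ _ Sr Tq.
- move=> r Tr; apply: im_gen => //; have [vr|nr] := pselect (adj v r.1); [by left|right].
  by have [_ _ _ _ ->] := ST _ _ Sp Tr.
Qed.

Lemma chordal_bipartite_centralizer (Gamma : graph) (g x y : raag Gamma) :
  chordal_bipartite Gamma -> commute x g -> commute y g -> ~ commute x y ->
  exists c (S T : Gamma -> Prop), [/\ complete_to S T, par S (g ^ c),
    par_mod T (g ^ c) (x ^ c) & par_mod T (g ^ c) (y ^ c)].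
Proof.
pose Q (Gamma : graph) (g x y : raag Gamma) := exists c (S T : Gamma -> Prop),
  [/\ complete_to S T, par S (g ^ c), par_mod T (g ^ c) (x ^ c) & par_mod T (g ^ c) (y ^ c)].
move: Gamma g x y; apply: (@centralizer_ind chordal_bipartite Q).
- exact: chordal_bipartite_unfold.
- move=> Gamma v g x y [c [S [T [ST Sg Tx Ty]]]].
  have [j [S' [T' [ST' SS' TT']]]] := fold_complete ST.
  have tr z : par_mod T (g ^ c) (z ^ c) ->
      par_mod T' (fold g ^ (fold c * zpow (gen v) j)) (fold z ^ (fold c * zpow (gen v) j)).
    move=> [b [k [m [n [Tb E]]]]]; exists (fold b ^ zpow (gen v) j), k, m, n; split.
      exact: par_fold_conj TT' Tb.
    by rewrite !conjgM -!foldJ -!conjXg -!foldX -!conjMg -!foldM E.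
  exists (fold c * zpow (gen v) j), S', T'; split=> //; try exact: tr.
  by rewrite conjgM -foldJ; apply: par_fold_conj SS' Sg.
- move=> Gamma c g x y [d [S [T [ST Sg Tx Ty]]]].
  by exists (c * d), S, T; rewrite !conjgM.
move=> Gamma u x y CG nz; set g := wd u => xg yg xy.
have [u0|] := eqVneq u [::].
  exists 1, (fun=> False), (fun=> True); split=> //.
  - by rewrite conjg1 /g u0 wd_nil; apply: par1.
  - by exists x, 0%N, 0%N, 0%N; rewrite conjg1; split=> //; apply: parT.
  - by exists y, 0%N, 0%N, 0%N; rewrite conjg1; split=> //; apply: parT.
case: u @g nz xg yg => // -[v sg] u; set u' := _ :: u => g nz xg yg _.
pose S (w : Gamma) : Prop := (w : {classic Gamma}) \in map fst u'.
pose T (t : Gamma) := forall w : {classic Gamma}, w \in map fst u' -> adj (w : Gamma) t.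
have Sv : S v by apply: mem_head.
have Sg : par S g by apply: par_wd => l lu; apply: map_f.
have [k [m [n]]] := balance x (nz _ Sv); set x' := _ * _ => x0.
have [k' [m' [n']]] := balance y (nz _ Sv); set y' := _ * _ => y0.
have x'g : commute x' g by apply: commute_mulX.
have y'g : commute y' g by apply: commute_mulX.
have xy' : ~ commute x' y' by move=> /(commute_balanced xg yg).
(* If [w] is adjacent to [v], the retract [h] of [g ^ c] keeps a nonzero [w]-exponent, so balanced
   elements of the link of [v] move into the link of [w]. Without triangles these links are
   disjoint, so such elements are trivial. *)
have nadj w : S w -> ~ adj v w.
  move=> Sw vw; apply: xy'.
  have [c [_ xc yc]] := commute_expo_conj (nz _ Sv) x'g y'g x0 y0.
  set r := ret (adj v) in xc yc; pose h := r (g ^ c).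
  have xr : r (x' ^ c) = x' ^ c by rewrite xc; apply: par_ret.
  have yr : r (y' ^ c) = y' ^ c by rewrite yc; apply: par_ret.
  have xh : commute (x' ^ c) h.
    by rewrite -xr; apply: (gmulf_commute (ret (adj v))); apply/commuteJ.
  have yh : commute (y' ^ c) h.
    by rewrite -yr; apply: (gmulf_commute (ret (adj v))); apply/commuteJ.
  have h0 : expo w h <> 0%Z by rewrite /h /r expo_ret_in // expoJ; apply: nz.
  have hv : par (adj v) h by apply: par_ret.
  have [k1 [m1 [n1]]] := balance (x' ^ c) h0; set x2 := _ * _ => x20.
  have [k2 [m2 [n2]]] := balance (y' ^ c) h0; set y2 := _ * _ => y20.
  have x2h : commute x2 h by apply: commute_mulX.
  have y2h : commute y2 h by apply: commute_mulX.
  have [d [_ xd yd]] := commute_expo_conj h0 x2h y2h x20 y20.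
  have triv z : par (adj v) z -> z ^ d = ret (adj w) z -> z = 1.
    move=> vz zd; apply: (@conjg_inj _ d); rewrite conj1g zd.
    by apply: ret_eq1 vz => t wt vt; apply: (triangle_free_adj CG vw wt vt).
  have x21 : x2 = 1.
    by apply: triv xd; apply: parM; [apply: parX | apply/parM/parV; apply: parX].
  apply/(commuteJ c); apply: (@commute_balanced _ _ _ _ k1 m1 n1 k2 m2 n2 xh yh).
  by rewrite -/x2 x21; apply/commute_sym/commute1.
have main z : commute z g -> expo v z = 0%Z -> par T z.
  move=> zg z0; have [c [/(_ S Sg) Sc zc _]] := commute_expo_conj (nz _ Sv) zg zg z0 z0.
  have zT : par T (z ^ c).
    apply: par_all => w Sw.
    have zw : expo w z = 0%Z by rewrite -(expoJ _ _ c) zc; apply: expo_ret_out; apply: nadj.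
    have [d [/(_ S Sg) Sd zd _]] := commute_expo_conj (nz _ Sw) zg zg zw zw.
    have -> : z ^ c = ret (adj v) (z ^ c) by rewrite zc; apply/esym/par_ret.
    rewrite -[z](conjgK d) zd -conjgM retJ (@ret_eq1 _ (adj v) S (d^-1 * c)).
    - by rewrite conjg1; apply/par_ret2/par_ret.
    - by move=> t vt /nadj.
    - exact/parM/Sc/parV.
  rewrite -(conjgK c z) (_ : (z ^ c) ^ c^-1 = z ^ c) //.
  apply/conj_fix_commute/commuteV; apply: commute_par zT Sc => t w Tt Sw.
  exact/gen_commute/adj_sym/Tt.
have mix z i a b : par T (z ^+ i.+1 * (g ^+ a / g ^+ b)) -> par_mod T (g ^ 1) (z ^ 1).
  move=> Tz; exists (z ^+ i.+1 * (g ^+ a / g ^+ b)), i, a, b; split=> //.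
  by rewrite !conjg1 !mulgA mulgVK.
exists 1, S, T; split.
- by move=> s t Ss; apply.
- by rewrite conjg1.
- by apply: (mix x k m n); apply: main.
- by apply: (mix y k' m' n'); apply: main.
Qed.

(** Removes the powers of [g] from [par_mod]. As [g] and [z] do not commute, a conjugate of [x] is
    supported on some [S1], which has no edges. If [S1] meets [S] it misses [T], so [x'] is trivial
    and [x] commutes with [y]; otherwise retracting onto [S] gives [g ^+ m = g ^+ n]. *)
Lemma chordal_bipartite_par (Gamma : graph) (S T : Gamma -> Prop) (g x y z : raag Gamma) :
  chordal_bipartite Gamma -> complete_to S T -> par S g -> par_mod T g x ->
  commute x g -> commute y g -> ~ commute x y -> commute z x -> ~ commute g z -> par T x.
Proof.
move=> CG ST Sg [x' [k [m [n [Tx' E]]]]] xg yg xy zx gz.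
have [c1 [S1 [T1 [ST1 S1x [g' [k1 [m1 [n1 [T1g' E1]]]]] _]]]] :=
  chordal_bipartite_centralizer CG (commute_sym xg) zx gz.
(* An edge in [S1] leaves no vertex for [T1]; a positive power of [g] is then a power of [x] up to
   sign of the exponent, and [g] commutes with [z]. *)
have S1ind s t : S1 s -> S1 t -> ~ adj s t.
  move=> S1s S1t st; apply: gz; apply: (@commute_root _ _ _ k1).
  have g'1 : g' = 1.
    apply: par0 T1g' => w T1w.
    exact: (triangle_free_adj CG st (ST1 _ _ S1t T1w) (ST1 _ _ S1s T1w)).
  move: E1; rewrite g'1 mul1g -!conjXg -conjMg => /conjg_inj E1.
  apply: (@commute_cancelr _ _ (x ^+ m1)); last exact/commute_sym/commuteX.
  by rewrite E1; apply/commute_sym/commuteX.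
have kill (U : Gamma -> Prop) : (forall w, U w -> ~ S1 w) -> ret U x = 1.
  move=> US1; rewrite -(conjgK c1 x) retJ (@ret_eq1 _ U S1 (x ^ c1)) // ?conj1g //.
have TS t : T t -> ~ S t by move=> Tt St; apply: (adj_irrefl (ST _ _ St Tt)).
have retTg : ret T g = 1 by apply: ret_eq1 Sg; apply: TS.
have [[s Ss S1s]|noS] := pselect (exists2 s, S s & S1 s).
  have retTx : ret T x = 1.
    by apply: kill => t Tt S1t; apply: (S1ind _ _ S1s S1t); apply: ST.
  have x'1 : x' = 1.
    have := congr1 (ret T) E.
    by rewrite !retM !retX retTx retTg !expg1n !mulg1 Tx'.
  case: xy; apply: (@commute_root _ _ _ k); apply: (@commute_cancelr _ _ (g ^+ m)).
    by rewrite E x'1 mul1g; apply/commute_sym/commuteX.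
  exact/commute_sym/commuteX.
have retSx : ret S x = 1 by apply: kill => s Ss S1s; apply: noS; exists s.
apply: (@par_root _ _ _ k); suff -> : x ^+ k.+1 = x' by [].
have := congr1 (ret S) E; rewrite !retM !retX retSx expg1n mul1g Sg.
rewrite (ret_eq1 _ Tx') ?mul1g => [|s Ss /TS//].
by move=> gmn; apply: (mulIg (g ^+ n)); rewrite -E gmn.
Qed.

End CentralizerStructure.

(** * Commuting cycles *)

Section NewVertex.
Variables (Gamma : graph) (T : Gamma -> Prop).
Local Notation G' := (add_vertex T).

Fact incl_compat : compat (fun x : Gamma => gen (Some x : G')).
Proof. by move=> x y xy; apply: gen_commute. Qed.

Definition incl := raag_lift incl_compat.
HB.instance Definition _ := UMagmaMorphism.copy incl (raag_lift incl_compat).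

Lemma incl_gen x : incl (gen x) = gen (Some x : G').
Proof. exact: raag_lift_gen. Qed.

Definition collapse_gen (b : raag Gamma) (p : G') : raag Gamma := oapp (@gen Gamma) b p.

Fact collapse_compat b : (forall x, T x -> commute b (gen x)) -> compat (collapse_gen b).
Proof.
move=> bT [x|] [y|] //= xy; [exact: gen_commute | exact/commute_sym/bT | exact: bT].
Qed.

(** Taken with [b = 1] to show that [incl] reflects commutation, and with [b = gen w] to identify a
    twin with [w]. *)
Definition collapse b (bT : forall x, T x -> commute b (gen x)) := raag_lift (collapse_compat bT).
HB.instance Definition _ b bT :=
  UMagmaMorphism.copy (@collapse b bT) (raag_lift (collapse_compat bT)).

Lemma collapse_incl b bT a : @collapse b bT (incl a) = a.
Proof.
move: a; apply: (@hom_eq _ _ (@collapse b bT \o incl)%FUN idfun) => x /=.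
by rewrite incl_gen [LHS]raag_lift_gen.
Qed.

Fact commute_1_gen x : T x -> commute 1 (gen x : raag Gamma).
Proof. by move=> _; apply/commute_sym/commute1. Qed.

Lemma incl_commute a b : commute (incl a) (incl b) <-> commute a b.
Proof.
split=> [/(gmulf_commute (collapse commute_1_gen))|].
  by rewrite /= !collapse_incl.
exact: (gmulf_commute incl).
Qed.

Lemma commute_new a : commute (gen (None : G')) (incl a) <-> par T a.
Proof.
split=> [/commute_sym/commute_genP aN|aT].
  rewrite -(collapse_incl commute_1_gen a).
  apply: (@par_ind _ _ (fun a => par T (collapse commute_1_gen a))) aN => [|b c|b|[x|]].
  - by rewrite gmulf1; apply: par1.
  - by rewrite gmulfM; apply: parM.
  - by rewrite gmulfV; apply: parV.
  - by case=> // Tx; rewrite [collapse _ _]raag_lift_gen; apply: par_gen.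
  - by move=> _; rewrite [collapse _ _]raag_lift_gen; apply: par1.
move: a aT; apply: (@par_ind _ _ (fun a => commute _ (incl a))) => [|b c|b|x Tx].
- by rewrite gmulf1; apply: commute1.
- by rewrite gmulfM; apply: commuteM.
- by rewrite gmulfV; apply: commuteV.
- by rewrite incl_gen; apply: gen_commute.
Qed.

End NewVertex.

(** The quotient of the two has exponent 0 and commutes with [gen w], so it is fixed by the
    retraction to the link of [w], which kills [gen w]. *)
Lemma commute_conj_gen (Gamma : graph) (w : Gamma) (c : raag Gamma) :
  commute (gen w ^ c) (gen w) -> gen w ^ c = gen w.
Proof.
move=> cw; apply/divg1_eq; have cw' : commute (gen w ^ c / gen w) (gen w).
  by apply: commute_mull => //; apply/commute_sym/commuteV.
have w0 : expo w (gen w ^ c / gen w) = 0%Z by rewrite expoM expoJ expoV; lia.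
rewrite -(commute_gen_expo0 cw' w0) retM retJ retV ret_genN; last exact: adj_irrefl.
by rewrite conj1g mul1g invg1.
Qed.

Definition word_incl (Gamma : graph) (T : Gamma -> Prop) (u : word Gamma) :
    word (add_vertex T) :=
  [seq ((Some l.1 : add_vertex T) : {classic (add_vertex T)}, l.2)
  | l : {classic Gamma} * bool <- u].

Lemma incl_wd (Gamma : graph) (T : Gamma -> Prop) (u : word Gamma) :
  incl T (wd u) = wd (word_incl T u).
Proof.
elim: u => [|[x b] u IHu] /=; first by rewrite !wd_nil gmulf1.
rewrite !wd_cons gmulfM /= IHu; congr (_ * _).
by rewrite /letter; case: b; rewrite /= ?gmulfV /= incl_gen.
Qed.

(** Unfolding keeps the shape of a vertex conjugate; the exponent of the conjugator turns into the
    level of the vertex. *)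
Lemma unfE_conj (Gamma : graph) (v x : Gamma) (u : word Gamma) : x <> v ->
  unfE v 0 (gen x ^ (wd u)^-1) =
  gen ((x, lev v x (wexpo v u)) : unfold v) ^ (wd (unf v 0 u))^-1.
Proof.
move=> xv; set a := wd u; set e := wexpo v u.
have unfV : unfE v e a^-1 = (unfE v 0 a)^-1.
  apply: (mulgI (unfE v 0 a)); rewrite mulgV -(unfE1 v 0) -(mulgV a) unfEM.
  by rewrite expo_wd.
have ux j : unfE v j (gen x) = gen ((x, lev v x j) : unfold v).
  have -> : gen x = wd [:: (x : {classic Gamma}, true)] by rewrite wd_cons wd_nil mulg1.
  rewrite unfE_wd /=; case: eqP => [/xv //|_].
  by rewrite wd_cons wd_nil mulg1.
rewrite conjgE invgK !unfEM expo_wd expo_gen_neq // Z.add_0_l Z.add_0_r unfV ux.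
by rewrite conjgE invgK unfE_wd.
Qed.

Definition commuting_cycle (G : groupType) (n : nat) (g : nat -> G) :=
  forall i j, (i < n)%N -> (j < n)%N -> i <> j -> (commute (g i) (g j) <-> consec n i j).

Lemma cycle_nbrs n i : (5 <= n)%N -> (i < n)%N -> exists a b c d,
  [/\ (a < n)%N, (b < n)%N, (c < n)%N & (d < n)%N] /\
  [/\ consec n i a, consec n i b, consec n a c, consec n b d & a <> b /\ ~ consec n a b] /\
  [/\ i <> c, i <> d, ~ consec n i c, ~ consec n i d &
    forall j, (j < n)%N -> consec n i j -> j = a \/ j = b].
Proof.
move=> n5 im; pose s k := (if (i + k < n)%N then i + k else i + k - n)%N.
(* The witnesses are [i - 1], [i + 1], [i - 2] and [i + 2] modulo [n]. *)
exists (s n.-1), (s 1%N), (s n.-2), (s 2); rewrite /s /consec.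
by (do 4!case: ifP => ?); do ?split; lia.
Qed.

Lemma consec_neq n i j : consec n i j -> (5 <= n)%N -> i <> j.
Proof. by rewrite /consec; lia. Qed.

(** Equal members commute, so [i] would be a neighbour of [j], and [g i = g j] would commute with
    the other neighbour, which is not consecutive to [i]. *)
Lemma commuting_cycle_neq (G : groupType) n (g : nat -> G) i j : (5 <= n)%N ->
  commuting_cycle n g -> (i < n)%N -> (j < n)%N -> i <> j -> g i <> g j.
Proof.
move=> n5 gC im jm ij gij.
have [a [b [_ [_ [[am bm _ _] [[ja jb _ _ [ab nab]] [_ _ _ _ nb]]]]]]] := cycle_nbrs n5 jm.
have ji : consec n j i.
  by apply/(gC _ _ jm im); [move/esym | rewrite gij; apply: commute_refl].
have gjb : commute (g j) (g b) by apply/gC => //; apply: consec_neq jb n5.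
have gja : commute (g j) (g a) by apply/gC => //; apply: consec_neq ja n5.
apply: nab; apply/(gC _ _ am bm ab).
have [ia|ib] := nb _ im ji; first by rewrite -ia gij.
by rewrite -ib gij; apply: commute_sym.
Qed.

Section CommutingCycles.
Variables (C : graph -> Prop) (n : nat).
Hypothesis n5 : (5 <= n)%N.
Hypothesis C_unfold : forall (Gamma : graph) (v : Gamma), C Gamma -> C (unfold v).
Hypothesis C_cycle : forall (Gamma : graph) (f : nat -> Gamma), C Gamma -> ~ induced_cycle n f.
(* The twin of [v] replaces [v] in vertex conjugates before unfolding at [v],
   as conjugates of [v] itself have exponent 1. *)
Hypothesis C_twin : forall (Gamma : graph) (v : Gamma), C Gamma ->
  exists T : Gamma -> Prop, [/\ C (add_vertex T), forall x, adj v x -> T x &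
    forall x, T x -> star v x].
Hypothesis C_centralizer : forall (Gamma : graph) (g : nat -> raag Gamma) i,
  C Gamma -> commuting_cycle n g -> (i < n)%N ->
  exists (T : Gamma -> Prop) c, [/\ C (add_vertex T),
    forall j, (j < n)%N -> consec n i j -> par T (g j ^ c) &
    forall z, par T (z ^ c) -> commute z (g i)].

Lemma commuting_cycle_to_vertices (Gamma : graph) (g : nat -> raag Gamma) :
  C Gamma -> commuting_cycle n g ->
  exists (Delta : graph) (h : nat -> raag Delta) (v : nat -> Delta),
    C Delta /\ commuting_cycle n (fun i => gen (v i) ^ (h i)^-1).
Proof.
move=> CG gC; suff : forall k, (k <= n)%N -> exists (Delta : graph) (g : nat -> raag Delta),
    [/\ C Delta, commuting_cycle n g &
      forall i, (i < k)%N -> exists v c, g i = gen v ^ c^-1].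
  move=> /(_ n (leqnn n)) [Delta [h [CD hC hv]]].
  have [v0 _] := hv 0%N ltac:(lia).
  have /choice[w wP] : forall i, exists vc : Delta * raag Delta,
      (i < n)%N -> h i = gen vc.1 ^ vc.2^-1.
    move=> i; have [im|_] := ltnP i n; last by exists (v0, 1).
    by have [v [c E]] := hv i im; exists (v, c).
  exists Delta, (fun i => (w i).2), (fun i => (w i).1); split=> // i j im jm ij.
  by rewrite -!wP //; apply: hC.
elim=> [_|k IHk kn]; first by exists Gamma, g; split.
have [Delta [h [CD hC hv]]] := IHk (ltnW kn).
have [T [c [CT hT Th]]] := C_centralizer CD hC kn.
pose new := gen (None : add_vertex T) ^ (incl T c)^-1.
pose h' i := if i == k then new else incl T (h i).
exists (add_vertex T), h'; split=> //; last first.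
  move=> i; rewrite ltnS leq_eqVlt => /orP[/eqP->|ik].
    by exists (None : add_vertex T), (incl T c); rewrite /h' eqxx.
  have [v [d E]] := hv i ik; exists (Some v : add_vertex T), (incl T d).
  by rewrite /h' ltn_eqF // E gmulfJ gmulfV /= incl_gen.
(* Commuting with the new vertex means lying in [T] after conjugation: [hT] gives this for
   neighbours, and [Th] leads back to commuting with [h k]. *)
have newP j : (j < n)%N -> k <> j -> (commute new (incl T (h j)) <-> consec n k j).
  move=> jm kj; rewrite -(commuteJ (incl T c)) /new conjgKV.
  have <- : incl T (h j ^ c) = incl T (h j) ^ incl T c by exact: gmulfJ.
  rewrite commute_new -hC //; split=> [/Th/commute_sym //|hkj].
  by apply: hT => //; apply/hC.
move=> i j im jm ij; rewrite /h'.
have [ik|_] := eqVneq i k.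
  have -> : (j == k) = false by apply/eqP => jk; apply: ij; rewrite ik jk.
  by rewrite ik; apply: newP => //; rewrite -ik.
have [jk|_] := eqVneq j k; last by rewrite incl_commute; apply: hC.
rewrite jk; have -> : commute (incl T (h i)) new <-> commute new (incl T (h i)).
  by split=> /commute_sym.
rewrite newP // -?jk; last exact/nesym.
by rewrite /consec; lia.
Qed.

(** Collapsing the twin onto [w] gives back the old cycle. Conversely, an element of [w]-exponent 0
    commuting with [w] lies in its link, so it commutes with the twin; and commuting conjugates of
    [w] coincide, which a commuting cycle forbids. *)
Lemma commuting_cycle_twin (Gamma : graph) (w : Gamma) (T : Gamma -> Prop)
    (h : nat -> word Gamma) (v : nat -> Gamma) :
  (forall x, adj w x -> T x) -> (forall x, T x -> star w x) ->
  commuting_cycle n (fun i => gen (v i) ^ (wd (h i))^-1) ->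
  commuting_cycle n (fun i =>
    gen ((if `[< v i = w >] then None else Some (v i)) : add_vertex T)
      ^ (wd (word_incl T (h i)))^-1).
Proof.
move=> wT Tw gC.
pose g i := gen (v i) ^ (wd (h i))^-1.
pose v' i : add_vertex T := if `[< v i = w >] then None else Some (v i).
pose g' i := gen (v' i) ^ (wd (word_incl T (h i)))^-1.
have wc x : T x -> commute (gen w) (gen x).
  by move=> /Tw[->|/gen_commute].
have g'_g i : collapse wc (g' i) = g i.
  rewrite /g' -incl_wd gmulfJ gmulfV /= collapse_incl; congr (_ ^ _).
  by rewrite [LHS]raag_lift_gen /v'; case: asboolP => // ->.
have g'_incl i : v i <> w -> g' i = incl T (g i).
  by move=> vw; rewrite /g' /v' asboolF // gmulfJ gmulfV /= incl_gen incl_wd.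
have half i j : v i = w -> v j <> w -> commute (g i) (g j) -> commute (g' i) (g' j).
  move=> vi vj; rewrite (g'_incl j vj) /g' /v' asboolT // -incl_wd /g vi.
  rewrite -[gen (v j) ^ _](conjgK (wd (h i))) commuteJ => /commute_sym cw.
  have -> : (incl T (wd (h i)))^-1 = incl T (wd (h i))^-1 by rewrite gmulfV.
  rewrite gmulfJ /= commuteJ; apply/commute_new.
  apply: (@par_sub _ (adj w)) => //; apply: commute_gen_expo0 cw _.
  by rewrite !expoJ expo_gen_neq.
move=> i j im jm ij; rewrite -(gC i j im jm ij) -/(g i) -/(g j) -/(g' i) -/(g' j).
split=> [/(gmulf_commute (collapse wc))|]; first by rewrite /= !g'_g.
have [vi|vi] := pselect (v i = w); have [vj|vj] := pselect (v j = w).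
- rewrite {1}/g {1}/g vi vj -[gen w ^ (wd (h j))^-1](conjgK (wd (h i))) commuteJ.
  rewrite -conjgM => /commute_sym/commute_conj_gen E.
  case: (commuting_cycle_neq n5 gC im jm ij).
  by rewrite vi vj -{1}E conjgM conjgK.
- exact: half.
- by move=> /commute_sym/(half _ _ vj vi)/commute_sym.
- by rewrite !g'_incl // incl_commute.
Qed.

(** Induction on the total length of the conjugators. A letter [w] of one of them is unfolded away
    once the twin has made all exponents of [w] zero; with no conjugators left, the vertices form an
    induced cycle. *)
Lemma no_commuting_vertex_cycle (Gamma : graph) (h : nat -> word Gamma) (v : nat -> Gamma) :
  C Gamma -> ~ commuting_cycle n (fun i => gen (v i) ^ (wd (h i))^-1).
Proof.
have [N] := ubnP (\sum_(i < n) size (h i)).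
elim: N Gamma h v => // N IHN Gamma h v hN CG gC.
have [[k km hk]|h0] := pselect (exists2 k, (k < n)%N & h k <> [::]); last first.
  have {}gC : commuting_cycle n (fun i => gen (v i)).
    move=> i j im jm ij; rewrite -(gC i j im jm ij).
    have hE k : (k < n)%N -> wd (h k) = 1.
      move=> km; suff -> : h k = [::] by apply: wd_nil.
      by apply: contrapT => hk; apply: h0; exists k.
    by rewrite !hE // invg1 !conjg1.
  apply: (C_cycle CG (f := v)) => i j im jm ij.
  have nv : v i <> v j by move=> E; apply: (commuting_cycle_neq n5 gC im jm ij); rewrite E.
  split=> //; rewrite -(gC i j im jm ij).
  by split=> [/gen_commute|/commute_gens_adj[]].
have [w wk] : exists w : Gamma, (w : {classic Gamma}) \in map fst (h k).
  by case: (h k) hk => // -[w b] u _; exists w; apply: mem_head.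
have [T [CT wT Tw]] := C_twin w CG.
have g'C := commuting_cycle_twin wT Tw gC.
pose v' i : add_vertex T := if `[< v i = w >] then None else Some (v i).
pose W i := word_incl T (h i); pose w' : add_vertex T := Some w.
pose g' i := gen (v' i) ^ (wd (W i))^-1.
have v'w i : v' i <> w' by rewrite /v'; case: asboolP => // vw [].
have g'0 i : expo w' (g' i) = 0%Z by rewrite expoJ expo_gen_neq.
have wW : (w' : {classic (add_vertex T)}) \in map fst (W k).
  have /mapP[l lh wl] := wk; apply/mapP; exists (w', l.2) => //.
  by rewrite /w' wl /W /word_incl; apply/mapP; exists l.
have sW i : size (W i) = size (h i) by apply: size_map.
apply: (IHN (unfold w') (fun i => unf w' 0 (W i))
  (fun i => (v' i, lev w' (v' i) (wexpo w' (W i))))).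
- apply: leq_trans _ (hN : (_ <= N)%N); rewrite (bigD1 (Ordinal km)) //= [ltnRHS](bigD1 (Ordinal km)) //=.
  rewrite -addSn; apply: leq_add; first by rewrite -sW; apply: size_unf_lt.
  by apply: leq_sum => i _; rewrite -sW; apply: size_unf.
- exact: C_unfold.
- move=> i j im jm ij; rewrite -!unfE_conj // -(g'C i j im jm ij).
  rewrite -/(g' i) -/(g' j).
  split=> [/(gmulf_commute (@fold _ w'))|]; last exact: (unfE_commute (g'0 i) (g'0 j)).
  by rewrite /= !fold_unfE.
Qed.

Lemma no_commuting_cycle (Gamma : graph) (g : nat -> raag Gamma) :
  C Gamma -> ~ commuting_cycle n g.
Proof.
move=> CG /(commuting_cycle_to_vertices CG)[Delta [h [v [CD hC]]]].
apply: (@no_commuting_vertex_cycle Delta (fun i => repr (h i)) v CD).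
by move=> i j im jm ij; rewrite !wd_repr; apply: hC.
Qed.

End CommutingCycles.

(** * The two classes of graphs *)

Lemma expo_letters (Gamma : graph) (u : word Gamma) (v : Gamma) :
  expo v (wd u) <> 0%Z -> (v : {classic Gamma}) \in map fst u.
Proof.
rewrite expo_wd => u0; apply: contrapT => /negP vu; apply: u0.
elim: u vu => //= l u IHu; rewrite inE negb_or => /andP[vl vu].
by rewrite IHu // /lexpo eq_sym (negbTE vl).
Qed.

(** Every [w] in [K] commutes with [a]; if its exponent is 0, [commute_gen_expo0] puts [a] in the
    link of [w], which misses [w]. *)
Lemma par_clique (Gamma : graph) (K : Gamma -> Prop) (a : raag Gamma) :
  (forall p q, K p -> K q -> p = q \/ adj p q) -> par K a ->
  par (fun x => K x /\ expo x a <> 0%Z) a.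
Proof.
move=> Kc Ka; have [u Ku aE] := par_word Ka.
pose s := [seq w : {classic Gamma} <- map fst u | `[< expo w a = 0%Z >]].
have sP w : w \in s -> par (fun x => w <> x) a.
  rewrite mem_filter => /andP[/asboolP w0 /mapP[l lu wl]].
  have wK : K w by rewrite wl; apply: Ku.
  apply: (@par_sub _ (adj w)); first by move=> x wx E; move: wx; rewrite E => /adj_irrefl.
  apply: commute_gen_expo0 w0; apply/commute_genP; apply: par_sub Ka => x Kx.
  by have [->|] := Kc _ _ wK Kx; [left|right].
have ua : par (fun x => (x : {classic Gamma}) \in map fst u) a.
  by rewrite aE; apply: par_wd => l lu; apply: map_f.
apply: par_sub (parI Ka (parI ua (par_all sP))) => x [Kx [xu xs]]; split=> // x0.
by apply: (xs x) => //; rewrite mem_filter xu andbT; apply/asboolP.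
Qed.

Lemma chordal_step n (Gamma : graph) (g : nat -> raag Gamma) i : (5 <= n)%N ->
  chordal Gamma -> commuting_cycle n g -> (i < n)%N ->
  exists (T : Gamma -> Prop) c, [/\ chordal (add_vertex T),
    forall j, (j < n)%N -> consec n i j -> par T (g j ^ c) &
    forall z, par T (z ^ c) -> commute z (g i)].
Proof.
move=> n5 CG gC im.
have [a [b [_ [_ [[am bm _ _] [[ia ib _ _ [ab nab]] _]]]]]] := cycle_nbrs n5 im.
have com j : (j < n)%N -> consec n i j -> commute (g j) (g i).
  by move=> jm ij; apply/commute_sym/gC => //; apply: consec_neq ij n5.
have [c [K0 [K0c K0g]]] : exists c (K : Gamma -> Prop),
    (forall p q, K p -> K q -> p = q \/ adj p q) /\ par K (g i ^ c).
  apply: (chordal_centralizer CG (com _ am ia) (com _ bm ib)).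
  by move=> /(gC _ _ am bm ab).
(* Vertices of exponent 0 are discarded because [commute_support] needs a nonzero exponent;
   [par_clique] keeps [g i ^ c] supported on the rest. *)
pose K x := K0 x /\ expo x (g i ^ c) <> 0%Z.
exists (fun x => forall k, K k -> star k x), c; split.
- by apply: chordal_add => // p q [Kp _] [Kq _]; apply: K0c.
- move=> j jm ij; pose s := [seq w : {classic Gamma} <- map fst (repr (g i ^ c)) | `[< K w >]].
  apply: (@par_sub _ (fun x => forall w, w \in s -> star w x)).
    move=> x sx k Kk; apply: sx; rewrite mem_filter; apply/andP; split; first exact/asboolP.
    by apply: expo_letters; rewrite wd_repr; case: Kk.
  apply: par_all => k; rewrite mem_filter => /andP[/asboolP[Kk k0] _].
  apply/commute_genP; apply: (commute_support K0g _ k0); last by rewrite commuteJ; apply: com.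
  by move=> x Kx; have [->|] := K0c _ _ Kk Kx; [left|right].
- move=> z Tz; apply/(commuteJ c); apply: commute_par Tz (par_clique K0c K0g).
  by move=> x k /[apply] -[->|/gen_commute/commute_sym].
Qed.

Lemma chordal_bipartite_step n (Gamma : graph) (g : nat -> raag Gamma) i : (5 <= n)%N ->
  chordal_bipartite Gamma -> commuting_cycle n g -> (i < n)%N ->
  exists (T : Gamma -> Prop) c, [/\ chordal_bipartite (add_vertex T),
    forall j, (j < n)%N -> consec n i j -> par T (g j ^ c) &
    forall z, par T (z ^ c) -> commute z (g i)].
Proof.
move=> n5 CG gC im.
have [a [b [a' [b' [[am bm am' bm'] [[ia ib aa bb [ab nab]] [ia' ib' na' nb' nbrs]]]]]]] :=
  cycle_nbrs n5 im.
have com j k : (j < n)%N -> (k < n)%N -> consec n j k -> commute (g k) (g j).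
  by move=> jm km jk; apply/commute_sym/gC => //; apply: consec_neq jk n5.
have nab' : ~ commute (g a) (g b) by move=> /(gC _ _ am bm ab).
have [c [S [T [ST Sg Ta Tb]]]] :=
  chordal_bipartite_centralizer CG (com _ _ im am ia) (com _ _ im bm ib) nab'.
(* With [S] empty, [g i] would be trivial and commute with [g a']. *)
have [s0 Ss0] : exists s0, S s0.
  apply: contrapT => S0; apply/na'/(gC _ _ im am' ia').
  have : g i ^ c = 1 by apply: par0 Sg => x Sx; apply: S0; exists x.
  rewrite -(conj1g c) => /conjg_inj ->; exact/commute_sym/commute1.
(* Two steps away from [i], [g l] commutes with [g j] but not with [g i], as [chordal_bipartite_par]
   requires. *)
have half j k l : (j < n)%N -> (k < n)%N -> (l < n)%N -> par_mod T (g i ^ c) (g j ^ c) ->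
    consec n i j -> consec n i k -> ~ commute (g j) (g k) -> consec n j l ->
    i <> l -> ~ consec n i l -> par T (g j ^ c).
  move=> jm km lm Tj ij ik njk jl il nil.
  apply: (@chordal_bipartite_par _ S T (g i ^ c) (g j ^ c) (g k ^ c) (g l ^ c)) => //;
    rewrite ?commuteJ //; try exact: com.
  by move=> /(gC _ _ im lm il).
exists (fun x => forall s, S s -> adj s x), c; split.
- exact: (@chordal_bipartite_add _ _ s0).
- move=> j jm ij; apply: (@par_sub _ T); first by move=> x Tx s Ss; apply: ST.
  have [->|->] := nbrs _ jm ij; first exact: (half a b a').
  apply: (half b a b') => //; by move/commute_sym.
- move=> z Tz; apply/(commuteJ c); apply: commute_par Tz Sg => x s /[apply].
  by move=> /gen_commute/commute_sym.
Qed.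

Lemma weakly_chordal_no_commuting_cycle (Gamma : graph) n (g : nat -> raag Gamma) :
  weakly_chordal Gamma -> triangle_free Gamma \/ square_free Gamma -> (5 <= n)%N ->
  ~ commuting_cycle n g.
Proof.
move=> wc tfsf n5.
have long m (f : nat -> Gamma) : (5 <= m)%N -> ~ induced_cycle m f.
  by move=> m5 /induced_cycle_contains; have [] := wc m m5.
case: tfsf => [tf|sf].
- have CG : chordal_bipartite Gamma.
    by move=> m f [->|]; [move=> /induced_cycle_contains | apply: long].
  apply: (@no_commuting_cycle chordal_bipartite n n5) => //.
  + exact: chordal_bipartite_unfold.
  + by move=> Delta f CD; apply: CD; right.
  (* This twin is not adjacent to [v]: such an edge would form a triangle with any common
     neighbour. *)
  + move=> Delta v CD; exists (fun x => forall s, v = s -> adj s x); split.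
    * exact: (@chordal_bipartite_add _ _ v).
    * by move=> x vx s <-.
    * by move=> x /(_ v erefl); right.
  + by move=> Delta h i; apply: chordal_bipartite_step.
- have CG : chordal Gamma.
    move=> m f; rewrite leq_eqVlt => /orP[/eqP<-|]; last exact: long.
    by move=> /induced_cycle_contains.
  apply: (@no_commuting_cycle chordal n n5) => //.
  + exact: chordal_unfold.
  + by move=> Delta f CD; apply: CD; apply: ltnW.
  (* This twin is adjacent to [v]: otherwise two nonadjacent neighbours of [v] would complete an
     induced square. *)
  + move=> Delta v CD; exists (fun x => forall k, v = k -> star k x); split.
    * by apply: chordal_add => // p q <- <-; left.
    * by move=> x vx k <-; right.
    * by move=> x /(_ v erefl).
  + by move=> Delta h i; apply: chordal_step.
Qed.

Lemma cycle_gens_commute m :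
  commuting_cycle m.+1 (fun i => gen (inord i : cycle_graph m.+1)).
Proof.
move=> i j im jm ij; have nij : (inord i : 'I_m.+1) <> inord j.
  by move=> /(congr1 val) /=; rewrite !inordK.
have adjE : cycle_adj (inord i : 'I_m.+1) (inord j) <-> consec m.+1 i j.
  by rewrite cycle_adj_consec !inordK //; split=> [[]|].
split=> [/commute_gens_adj[/nij|/adjE]//|/adjE ij'].
exact: (@gen_commute (cycle_graph m.+1)).
Qed.

Theorem corollary49 (Gamma : graph) :
  weakly_chordal Gamma ->
  triangle_free Gamma \/ square_free Gamma ->
  forall n : nat, (5 <= n)%N ->
    ~ has_subgroup_isomorphic_to (raag Gamma) (raag (cycle_graph n)).
Proof.
move=> wc tfsf [//|n] n5 /has_subgroup_isomorphicP[f fI].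
apply: (@weakly_chordal_no_commuting_cycle Gamma n.+1
  (fun i => f (gen (inord i : cycle_graph n.+1))) wc tfsf n5).
move=> i j im jm ij; rewrite -(cycle_gens_commute im jm ij).
split=> [|/(gmulf_commute f)//]; rewrite /commute -!gmulfM; exact: fI.
Qed.
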